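(* Let $m\geq 3$ be an integer. Let $V=D^{(m+1,m)}$ be the spin module for the symmetric group $\Sigma_{2m+1}$ over $\mathbb{F}_2$, a vector space of dimension $2^m$ over $\mathbb{F}_2$. Let $\Sigma_{2m}$ be the stabilizer of a point in the natural action of $\Sigma_{2m+1}$ on $\{1,\dots,2m+1\}$, and let $U$ denote the socle of the restriction $V\downarrow_{\Sigma_{2m}}$. Let $g_1=1,g_2,\dots,g_{2m+1}$ be a set of left coset representatives for $\Sigma_{2m}$ in $\Sigma_{2m+1}$. Then $V$ carries a non-degenerate $\Sigma_{2m+1}$-invariant quadratic form $Q$, and with respect to $Q$ the $2m+1$ subspaces $U=g_1U, g_2U,\dots,g_{2m+1}U$ form a partial orthogonal spread in $V$ (that is, they are $2^{m-1}$-dimensional, totally singular, and $g_iU\cap g_jU=0$ for $i\neq j$). Moreover $\Sigma_{2m+1}$ permutes these $2m+1$ subspaces according to its natural action (i.e. the action on them is equivalent to the natural action on $\{1,\dots,2m+1\}$).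
   Context: Quadratic forms. A quadratic form on a vector space $V$ over a finite field $K$ of characteristic 2 is a function $Q:V\to K$ with $Q(\lambda u)=\lambda^2Q(u)$ and $Q(u+v)=Q(u)+Q(v)+f(u,v)$ for all $\lambda\in K$, $u,v\in V$, where $f$ is an alternating bilinear form (the polarization of $Q$). $Q$ is non-degenerate if $f$ is non-degenerate. $Q$ is invariant under a group $G$ acting linearly on $V$ if $Q(gv)=Q(v)$ for all $g\in G$, $v\in V$. A subspace is totally singular if $Q$ vanishes on all its elements. If $\dim V=2r$ and $Q$ is non-degenerate of index $r$ (i.e. there is an $r$-dimensional totally singular subspace), a partial orthogonal spread is a set of $r$-dimensional totally singular subspaces that pairwise intersect trivially. Modules for symmetric groups. For a partition $\lambda$ of $n$ with no two equal parts (a 2-regular partition), $D^\lambda$ denotes the corresponding irreducible $\mathbb{F}_2\Sigma_n$-module, in the standard labelling: $D^\lambda=S^\lambda/(S^\lambda\cap (S^\lambda)^\perp)$, where $S^\lambda$ is the Specht module over $\mathbb{F}_2$, a submodule of the permutation module on $\lambda$-tabloids, and $\perp$ is taken with respect to the bilinear form on that permutation module for which the tabloids are orthonormal. The spin module of $\Sigma_{2m+1}$ over $\mathbb{F}_2$ is $D^{(m+1,m)}$ (of dimension $2^m$). The socle of a module is the sum of its irreducible submodules. *)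

(* Defs.v *)
From mathcomp Require Import all_boot all_algebra all_fingroup all_character.

Set Implicit Arguments.
Unset Strict Implicit.
Unset Printing Implicit Defensive.

Import GroupScope GRing.Theory.
Local Open Scope ring_scope.

(* Convention: the product s * t of permutations is "first s, then t", i.e.   *)
(* t \o s, so 'S_n is the opposite of the symmetric group for composition of  *)
(* functions.  Accordingly a left module is a MathComp representation acting  *)
(* on row vectors from the right, g.v being v *m rG g, and the left coset gH  *)
(* of the functions g \o h (h in H) is H :* g.                                *)

Section QuadraticForms.

Variables (K : fieldType) (V : lmodType K).
Implicit Type Q : V -> K.

(* In characteristic 2. *)
Definition is_polarization Q (f : {biscalar V}) : Prop :=
  (forall u, f u u = 0) /\ (forall u v, Q (u + v) = Q u + Q v + f u v).

Definition quadratic_form Q : Prop :=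
  (forall a u, Q (a *: u) = a ^+ 2 * Q u) /\
  (exists f : {biscalar V}, is_polarization Q f).

(* Q determines its polarization, so the quantifier over f is harmless. *)
Definition nondegenerate_form Q : Prop :=
  exists2 f : {biscalar V}, is_polarization Q f &
    forall u, (forall v, f u v = 0) -> u = 0.

End QuadraticForms.

Definition invariant_form (K : fieldType) (gT : finGroupType) (G : {group gT})
    (d : nat) (rG : mx_representation K G d) (Q : 'rV[K]_d -> K) : Prop :=
  forall g v, g \in G -> Q (v *m rG g) = Q v.

Definition totally_singular (K : fieldType) (d k : nat) (Q : 'rV[K]_d -> K)
    (W : 'M[K]_(k, d)) : Prop :=
  forall v : 'rV[K]_d, (v <= W)%MS -> Q v = 0.

(* The subspaces of the spread are the row spaces of the W i. *)
Definition partial_orthogonal_spread (K : fieldType) (d : nat)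
    (Q : 'rV[K]_d -> K) (r : nat) (I : finType) (W : I -> 'M[K]_d) : Prop :=
  [/\ d = (2 * r)%N,
      quadratic_form Q /\ nondegenerate_form Q,
      exists2 E : 'M[K]_d, \rank E = r & totally_singular Q E,
      forall i, \rank (W i) = r /\ totally_singular Q (W i)
    & forall i j, i != j -> (W i :&: W j :=: (0 : 'M[K]_d))%MS].

Definition left_coset_representatives (gT : finGroupType) (H : {set gT})
    (I : finType) (g : I -> gT) : Prop :=
  forall x : gT, exists! i : I, x \in H :* g i.

Section Specht.

Variables (F : fieldType) (n : nat) (la : seq nat).

Definition cell : finType := {i : 'I_(size la) & 'I_(nth 0%N la i)}.
Definition cell_row (c : cell) : 'I_(size la) := tag c.
Definition cell_col (c : cell) : nat := tagged c.

(* A tableau is encoded by the map sending each entry to its cell. *)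
Definition is_tableau (t : {ffun 'I_n -> cell}) : bool :=
  injectiveb t && [forall c, c \in codom t].

(* A tabloid is encoded by the map sending each entry to its row. *)
Definition is_tabloid (f : {ffun 'I_n -> 'I_(size la)}) : bool :=
  [forall i, #|[set x | f x == i]| == nth 0%N la i].

Definition tabloid : finType := {f | is_tabloid f}.

Definition row_act (f : {ffun 'I_n -> 'I_(size la)}) (g : 'S_n) :
    {ffun 'I_n -> 'I_(size la)} :=
  [ffun x => f (g^-1%g x)].

Lemma row_act1 f : row_act f 1%g = f.
Proof. by apply/ffunP=> x; rewrite ffunE invg1 perm1. Qed.

Lemma row_actM f g h : row_act f (g * h)%g = row_act (row_act f g) h.
Proof. by apply/ffunP=> x; rewrite !ffunE invMg permM. Qed.

Lemma row_act_inj g : injective (row_act ^~ g).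
Proof.
apply: (can_inj (g := row_act ^~ g^-1%g)) => f.
by rewrite -row_actM mulgV row_act1.
Qed.

Lemma row_act_tabloid (T : tabloid) g : is_tabloid (row_act (val T) g).
Proof.
apply/forallP=> i; rewrite -(eqP (forallP (valP T) i)).
have -> : [set x | row_act (val T) g x == i] = g @: [set x | val T x == i].
  apply/setP=> y; rewrite inE ffunE; apply/idP/imsetP=> [Ty | [x]].
    by exists (g^-1%g y); rewrite ?inE ?permKV.
  by rewrite inE => Tx ->; rewrite permK.
by rewrite card_imset //; apply: perm_inj.
Qed.

Definition tabloid_act (T : tabloid) (g : 'S_n) : tabloid :=
  Sub (row_act (val T) g) (row_act_tabloid T g).

Definition tabloid_mx (g : 'S_n) : 'M[F]_#|{: tabloid}| :=
  \matrix_(i, j) (tabloid_act (enum_val i) g == enum_val j)%:R.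

Lemma mul_tabloid_mx (v : 'rV[F]_#|{: tabloid}|) g :
  v *m tabloid_mx g =
  \row_j v 0 (enum_rank (tabloid_act (enum_val j) g^-1%g)).
Proof.
apply/rowP=> j; rewrite !mxE.
set k := enum_rank _.
have kE : tabloid_act (enum_val k) g = enum_val j.
  by apply: val_inj; rewrite /k enum_rankK /= -row_actM mulVg row_act1.
rewrite (bigD1 k) //= mxE kE eqxx mulr1 big1 ?addr0 // => i ik.
rewrite mxE; case: eqP => [Ei|]; last by rewrite mulr0.
case/eqP: ik; apply: enum_val_inj; rewrite /k enum_rankK -Ei.
by apply: val_inj; rewrite /= -row_actM mulgV row_act1.
Qed.

Lemma tabloid_mx_repr : mx_repr [set: 'S_n]%G tabloid_mx.
Proof.
split=> [|g h _ _].
  apply/row_matrixP=> i; rewrite !rowE mul_tabloid_mx mulmx1.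
  apply/rowP=> j; rewrite mxE; congr (delta_mx _ _ _ _).
  rewrite -[RHS]enum_valK; congr (enum_rank _).
  by apply: val_inj; rewrite /= invg1 row_act1.
apply/row_matrixP=> i; rewrite row_mul !rowE !mul_tabloid_mx.
apply/rowP=> j; rewrite !mxE enum_rankK; congr (_ && (enum_rank _ == _))%:R.
by apply: val_inj; rewrite /= invMg row_actM.
Qed.

Definition tabloid_repr : mx_representation F [set: 'S_n]%G #|{: tabloid}| :=
  MxRepresentation tabloid_mx_repr.

Definition tableau_rows (t : {ffun 'I_n -> cell}) :
    {ffun 'I_n -> 'I_(size la)} :=
  [ffun x => cell_row (t x)].

Definition column_stabilizer (t : {ffun 'I_n -> cell}) : {set 'S_n} :=
  [set s : 'S_n | [forall x, cell_col (t (s x)) == cell_col (t x)]].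

(* The coordinates of the sum over s of sgn(s) s{t}, s in the column          *)
(* stabilizer of t.                                                           *)
Definition polytabloid (t : {ffun 'I_n -> cell}) : 'rV[F]_#|{: tabloid}| :=
  \row_j \sum_(s in column_stabilizer t |
               row_act (tableau_rows t) s == val (enum_val j)) (-1) ^+ s.

Definition specht : 'M[F]_#|{: tabloid}| :=
  (\sum_(t : {ffun 'I_n -> cell} | is_tableau t) <<polytabloid t>>)%MS.

(* Tabloids are the standard basis of the permutation module. *)
Definition specht_perp : 'M[F]_#|{: tabloid}| := kermx specht^T.

Lemma polytabloid_act t g :
  polytabloid t *m tabloid_mx g = polytabloid [ffun x => t (g^-1%g x)].
Proof.
rewrite mul_tabloid_mx; apply/rowP=> j; rewrite !mxE enum_rankK /=.
rewrite (reindex_inj (conjg_inj g^-1%g)) /=; apply: eq_big => [s|s _].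
  congr andb.
    rewrite !inE; apply/forallP/forallP=> H x.
      have := H (g^-1%g x); rewrite !ffunE.
      by rewrite conjgE invgK !permM permKV.
    have := H (g x); rewrite !ffunE permK.
    by rewrite conjgE invgK !permM.
  rewrite conjgE invgK mulgA row_actM (inj_eq (@row_act_inj _)) row_actM.
  by congr (row_act _ _ == _); apply/ffunP=> x; rewrite !ffunE.
by congr (_ ^+ _); rewrite odd_permJ.
Qed.

Lemma specht_module : mxmodule tabloid_repr specht.
Proof.
apply/mxmoduleP=> g _; rewrite /specht sumsmxMr; apply/sumsmx_subP=> t tabt.
apply: (submx_trans (submxMr _ _ : (_ <= polytabloid t *m tabloid_mx g)%MS)).
  by rewrite genmxE.
rewrite polytabloid_act.
set t' := [ffun x => _]; apply: submx_trans (sumsmx_sup t' _ (submx_refl _)).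
  by rewrite genmxE.
case/andP: tabt => /injectiveP tI /forallP tS; apply/andP; split.
  by apply/injectiveP=> x y; rewrite !ffunE => /tI /perm_inj.
apply/forallP=> c; have /codomP[x ->] := tS c.
by apply/codomP; exists (g x); rewrite ffunE permK.
Qed.

Lemma tabloid_mx_tr g : (tabloid_mx g)^T = tabloid_mx g^-1%g.
Proof.
apply/matrixP=> i j; rewrite !mxE; congr (nat_of_bool _)%:R.
by apply/eqP/eqP=> <-; apply: val_inj;
  rewrite /= -row_actM ?mulgV ?mulVg row_act1.
Qed.

Lemma specht_perp_module : mxmodule tabloid_repr specht_perp.
Proof.
apply/mxmoduleP=> g _; apply/sub_kermxP.
rewrite -mulmxA -[tabloid_repr g]trmxK -trmx_mul [X in _ *m X^T]/=.
have /mxmoduleP/(_ g^-1%g (in_setT _))/submxP[D defD] := specht_module.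
by rewrite /= tabloid_mx_tr defD trmx_mul mulmxA mulmx_ker mul0mx.
Qed.

Lemma specht_radical_module :
  mxmodule tabloid_repr (specht :&: specht_perp)%MS.
Proof. exact: capmx_module specht_module specht_perp_module. Qed.

(* The module S / (S :&: S^perp). *)
Definition D_dim : nat :=
  \rank <<in_factmod (specht :&: specht_perp)%MS specht>>%MS.

Definition D_repr : mx_representation F [set: 'S_n]%G D_dim :=
  section_repr specht_radical_module specht_module.

End Specht.

Definition spin_dim (m : nat) : nat := D_dim 'F_2 (2 * m).+1 [:: m.+1; m].

Definition spin_repr (m : nat) :
    mx_representation 'F_2 [set: 'S_(2 * m).+1]%G (spin_dim m) :=
  D_repr 'F_2 (2 * m).+1 [:: m.+1; m].

Definition point_stabilizer (n : nat) (p : 'I_n) : {group 'S_n} :=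
  'C_[set: 'S_n]%G[p | 'P]%G.

(* Row space: the socle of the restriction to H. *)
Definition restriction_socle (F : decFieldType) (gT : finGroupType)
    (G H : {group gT}) (d : nat) (rG : mx_representation F G d)
    (sHG : H \subset G) : 'M[F]_d :=
  Socle (DecSocleType (subg_repr rG sHG)).

(* Main.v *)
From HB Require Import structures.
Require Import Defs.
From mathcomp Require Import all_boot all_algebra all_fingroup all_character.

Set Implicit Arguments.
Unset Strict Implicit.
Unset Printing Implicit Defensive.
Import GroupScope GRing.Theory.
Local Open Scope ring_scope.

(* A polytabloid of shape (m+1,m) over F_2 depends only on a matching with m  *)
(* edges and one unmatched point; its tabloids are the m-sets crossing every  *)
(* edge, so the inner product of two polytabloids counts common crossing sets *)
(* modulo 2.  Fixed-point-free flips of coordinates show that (ij)+(jk)+(ik)  *)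
(* maps the Specht module S into its radical, so the transpositions act on    *)
(* D = S/(S :&: S^perp) through a Clifford algebra: the operators (ip), for p *)
(* fixed, have square 1 and anticommutators 1.  This forces dim D = 2^m, with *)
(* the image of each polytabloid as the only nonzero vector fixed by the      *)
(* transpositions of its matching, hence contained in every nonzero submodule *)
(* for the stabilizer of the unmatched point p.  The socle U_p is therefore   *)
(* spanned by the polytabloids with unmatched point p.  It is also the kernel *)
(* of N_p = m + sum_i (ip), where N_p^2 = 0 and N_p (ip) + (ip) N_p = 1, which *)
(* gives dim U_p = 2^(m-1); and U_p :&: U_q = 0 because N_p + N_q = (pq).     *)
(* The quadratic form is half of the Hamming weight.  It vanishes on the      *)
(* submodule I generated by the images of the (ij)+(jk)+(ik); the dimension   *)
(* count applies to S/I as well, so I is the whole radical and the form       *)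
(* descends to D.                                                             *)

(** Write S for the Specht module, R for its radical, I for [star_submodule], and [pt l] for the
    polytabloid of a matching [l]. Everything rests on one relation: (ij)+(jk)+(ik) sends [pt l]
    into R ([star_relation_perp]). Read in the labels of [l], the coefficients of the image either
    cancel identically or are unchanged when a suitable nonempty set of points is flipped, so the
    terms of the inner product pair off. Hence on S/A, for any submodule A between I and R, the
    operators (ip) satisfy Clifford relations ([star_anti]). Section [Spin] works only from the
    relation and from a cyclic vector e fixed by the edges of the matching; it yields the dimension
    ([spin_dimE]), the socle as the kernel of a square-zero operator ([stab_span_socle],
    [stab_span_jm], [stab_span_rank]) and the trivial intersections ([kermx_jm_cap]).

    The half weight descends to S/R because it vanishes on I ([star_submodule_radical]) and I = R by
    dimensions ([half_weight_radical]). Its polarization is the inner product, which is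
    non-degenerate once R is divided out, and it is invariant because permutations only permute
    tabloids. The socle U is spanned by polytabloids with a common unmatched point; they are
    pairwise orthogonal ([dot_pt_unmatched]) and their weight 2^m is divisible by 4, so U is totally
    singular ([socle_singular]). The translate of U by x is the kernel attached to the point x p
    ([socle_conj]), which gives both the intersections and the permutation action. *)

Section CharTwo.

Variables (p q : nat).
Implicit Types A B : 'M['F_2]_(p, q).

Lemma addF2 (a : 'F_2) : a + a = 0.
Proof. exact/addrr_pchar2/pchar_Fp. Qed.

Lemma addmxF2 A : A + A = 0.
Proof. by apply/matrixP=> i j; rewrite !mxE addF2. Qed.

Lemma oppmxF2 A : - A = A.
Proof. by apply/eqP; rewrite eq_sym -addr_eq0 addmxF2. Qed.

Lemma addmxF2K A B : A + B + B = A.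
Proof. by rewrite -addrA addmxF2 addr0. Qed.

Lemma addmxF2_eq A B : A + B = 0 -> A = B.
Proof. by move/(canRL (addrK _)); rewrite sub0r oppmxF2. Qed.

End CharTwo.

Lemma F2_cases (a : 'F_2) : a = 0 \/ a = 1.
Proof.
by case: a => [[|[|//]] h]; [left|right]; apply: val_inj.
Qed.

(** [A] is a contracting homotopy for the differential [N] on [F]: a vector k killed by [N] equals k
    A N, so kernel and image of [N] on [F] coincide, and rank-nullity gives the factor 2. *)
Lemma two_nilpotent_halves (d : nat) (F N A : 'M['F_2]_d) :
    (F *m N <= F)%MS -> (F *m A <= F)%MS -> N *m N = 0 ->
    N *m A + A *m N = 1%:M ->
  (2 * \rank (F :&: kermx N) = \rank F)%N.
Proof.
move=> FN FA NN NA.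
rewrite -[RHS](mxrank_mul_ker F N) mul2n -addnn; congr (_ + _)%N.
apply/eqmx_rank/andP; split; last first.
  by rewrite sub_capmx FN /=; apply/sub_kermxP; rewrite -mulmxA NN mulmx0.
set K := (F :&: _)%MS; have KN : K *m N = 0.
  by apply/sub_kermxP; apply: capmxSr.
rewrite -[K]mulmx1 -NA mulmxDr !mulmxA KN mul0mx add0r.
apply: submxMr; apply: submx_trans FA; apply: submxMr; exact: capmxSl.
Qed.

(* A labelling l : label m -> 'I_(2 * m).+1 encodes a matching with edges       *)
(* {l (Some (c, false)), l (Some (c, true))} and unmatched point l None.        *)
Definition label (m : nat) : finType := option ('I_m * bool)%type.

(** * Matchings with one unmatched point *)

Section Label.

Variables (m : nat) (l : label m -> 'I_(2 * m).+1).
Hypothesis l_inj : injective l.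
Local Notation p := (l None).
Local Notation al c := (l (Some (c, false))).
Local Notation be c := (l (Some (c, true))).

Lemma label_bij : bijective l.
Proof.
apply: inj_card_bij => //.
by rewrite card_option card_prod card_bool !card_ord mulnC.
Qed.

Lemma label_surj i : exists k, i = l k.
Proof. by have [g gK Kg] := label_bij; exists (g i); rewrite Kg. Qed.

Lemma left_neq_free c : al c != p. Proof. by rewrite (inj_eq l_inj). Qed.
Lemma right_neq_free c : be c != p. Proof. by rewrite (inj_eq l_inj). Qed.
Lemma left_neq_right c k : al c != be k.
Proof. by rewrite (inj_eq l_inj); apply/eqP=> -[]. Qed.
Lemma left_eq c k : (al c == al k) = (c == k).
Proof. by rewrite (inj_eq l_inj) (inj_eq Some_inj) xpair_eqE eqxx andbT. Qed.
Lemma right_eq c k : (be c == be k) = (c == k).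
Proof. by rewrite (inj_eq l_inj) (inj_eq Some_inj) xpair_eqE eqxx andbT. Qed.

Lemma big_label (R : Type) (idx : R) (op : Monoid.com_law idx)
    (F : 'I_(2 * m).+1 -> R) :
  \big[op/idx]_i F i =
  op (F p) (\big[op/idx]_(c < m) op (F (al c)) (F (be c))).
Proof.
rewrite (reindex l) /=; last exact: onW_bij label_bij.
rewrite (bigD1 None) //=; congr (op _ _).
rewrite (reindex_omap Some id) => [|[k|]] //=.
transitivity (\big[op/idx]_(k : 'I_m * bool) F (l (Some (k.1, k.2)))).
  by apply: eq_big => [k|[c b]] //; rewrite eqxx.
rewrite -(pair_bigA _ (fun c b => F (l (Some (c, b))))) /=.
by apply: eq_bigr => c _; rewrite big_bool Monoid.mulmC.
Qed.

End Label.

(* The Jucys-Murphy element of q, shifted by a scalar so as to have square 0. *)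
Definition jm (m d : nat) (rG : mx_representation 'F_2 [set: 'S_(2 * m).+1]%G d)
    (q : 'I_(2 * m).+1) : 'M['F_2]_d :=
  \sum_(i | i != q) rG (tperm i q) + m%:R%:M.

(** * The Clifford relations and the restriction to a point stabilizer *)

Section Spin.

Variables (m d : nat).
Local Notation n := (2 * m).+1.
Variables (rG : mx_representation 'F_2 [set: 'S_n]%G d) (l : label m -> 'I_n).
Variable e : 'rV['F_2]_d.
Local Notation tr i j := (rG (tperm i j)).
Local Notation p := (l None).
Local Notation al c := (l (Some (c, false))).
Local Notation be c := (l (Some (c, true))).

Hypothesis tr3 : forall i j k, i != j -> j != k -> i != k ->
  tr i j + tr j k + tr i k = 0.
Hypothesis l_inj : injective l.
Hypothesis e_fix : forall c, e *m tr (al c) (be c) = e.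
Hypothesis e_gen : forall U : 'M_d, mxmodule rG U -> (e <= U)%MS -> (1%:M <= U)%MS.
Hypothesis e_neq0 : e != 0.

(** The value 0 at [p] lets [tr_star] express every transposition, including those that move [p]. *)
Let star i := if i == p then 0 else tr i p.
Let edge c := tr (al c) (be c).
Let edge_nilp c := 1%:M + edge c.
Let spoke c := star (al c).

Lemma repr_in (x y : 'S_n) : rG (x * y)%g = rG x *m rG y.
Proof. by rewrite repr_mxM ?in_setT. Qed.

Lemma tr_sq i j : tr i j *m tr i j = 1%:M.
Proof. by rewrite -repr_in tperm2 repr_mx1. Qed.

Lemma tr_conj x i j : rG x^-1%g *m tr i j *m rG x = tr (x i) (x j).
Proof. by rewrite -!repr_in -mulgA -conjgE tpermJ. Qed.

Lemma trC i j : tr i j = tr j i. Proof. by rewrite tpermC. Qed.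

Lemma tr_star i j : i != j -> tr i j = star i + star j.
Proof.
rewrite /star => ij; have [ip|ip] := eqVneq i p; have [jp|jp] := eqVneq j p.
- by rewrite ip jp eqxx in ij.
- by rewrite add0r ip trC.
- by rewrite addr0 jp.
by apply: addmxF2_eq; rewrite (addrC (tr i p)) addrA tr3.
Qed.

Lemma star_sq i : i != p -> star i *m star i = 1%:M.
Proof. by rewrite /star => /negPf->; rewrite tr_sq. Qed.

(** Square (ij) = [star i] + [star j]: all three squares are 1, so the cross terms add up to 1 - 2 =
    1. *)
Lemma star_anti i j : i != p -> j != p -> i != j ->
  star i *m star j + star j *m star i = 1%:M.
Proof.
move=> ip jp ij; have := tr_sq i j; rewrite tr_star // mulmxDl !mulmxDr.
rewrite !star_sq // => E.
by rewrite -[RHS]E addrA -(addrA 1%:M) [RHS]addrAC addmxF2 add0r.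
Qed.

Lemma edgeE c : edge c = star (al c) + star (be c).
Proof. by rewrite /edge tr_star // (left_neq_right l_inj). Qed.

Lemma edge_sq c : edge c *m edge c = 1%:M. Proof. exact: tr_sq. Qed.

(** An edge is the sum of its two stars. For c different from k both anticommutators are 1 and
    cancel; for c = k that of the spoke with itself is 2 = 0. *)
Lemma edge_spoke_anti c k : edge c *m spoke k + spoke k *m edge c = (c == k)%:R%:M.
Proof.
rewrite edgeE mulmxDl mulmxDr addrACA.
have bk : star (be c) *m spoke k + spoke k *m star (be c) = 1%:M.
  rewrite star_anti ?(left_neq_free l_inj) ?(right_neq_free l_inj) //.
  by rewrite eq_sym (left_neq_right l_inj).
rewrite bk; case: eqVneq => [->|ck].
  by rewrite addmxF2 add0r.
by rewrite star_anti ?(left_neq_free l_inj) ?(left_eq l_inj) // addmxF2 raddf0.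
Qed.

Lemma edge_spoke c k : edge c *m spoke k = spoke k *m edge c + (c == k)%:R%:M.
Proof. by rewrite -edge_spoke_anti addrCA addmxF2 addr0. Qed.

Lemma edge_comm c k : edge c *m edge k = edge k *m edge c.
Proof.
have [->//|ck] := eqVneq c k.
rewrite /edge -!repr_in; congr (rG _).
rewrite conjgC tpermJ !tpermD //;
  by [rewrite (left_eq l_inj) eq_sym | rewrite (right_eq l_inj) eq_sym
  | rewrite (left_neq_right l_inj) | rewrite eq_sym (left_neq_right l_inj)].
Qed.

Lemma edge_nilp_sq c : edge_nilp c *m edge_nilp c = 0.
Proof.
by rewrite /edge_nilp mulmxDl !mulmxDr !mulmx1 mul1mx edge_sq (addrC (edge c)) addmxF2.
Qed.

Lemma edge_nilp_spoke c : edge_nilp c *m spoke c + spoke c *m edge_nilp c = 1%:M.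
Proof.
by rewrite /edge_nilp mulmxDl mulmxDr mulmx1 mul1mx addrACA addmxF2 add0r edge_spoke_anti eqxx.
Qed.

Let fixed (s : seq 'I_m) := foldr (fun c F => (F :&: kermx (edge_nilp c))%MS) 1%:M s.

Lemma edge_nilp_comm c X : edge c *m X = X *m edge c -> edge_nilp c *m X = X *m edge_nilp c.
Proof. by rewrite /edge_nilp mulmxDl mulmxDr mul1mx mulmx1 => ->. Qed.

Lemma cap_stable k k' (U : 'M['F_2]_(k, d)) (W : 'M['F_2]_(k', d)) X :
  (U *m X <= U)%MS -> (W *m X <= W)%MS -> ((U :&: W)%MS *m X <= U :&: W)%MS.
Proof.
move=> UX WX; rewrite sub_capmx; apply/andP; split.
  by apply: submx_trans UX; rewrite submxMr ?capmxSl.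
by apply: submx_trans WX; rewrite submxMr ?capmxSr.
Qed.

Lemma fixed_stable s X : (forall c, c \in s -> edge c *m X = X *m edge c) ->
  (fixed s *m X <= fixed s)%MS.
Proof.
elim: s => [_|c s IH vX] /=; first exact: submx1.
apply: cap_stable.
  by apply: IH => b bs; rewrite vX // inE bs orbT.
by apply/comm_mx_stable_ker/edge_nilp_comm/vX; rewrite inE eqxx.
Qed.

(** Each new edge halves the common fixed space: [spoke c] commutes with the earlier edges, hence
    preserves their fixed space, and is a homotopy for [edge_nilp c]. *)
Lemma fixed_rank s : uniq s -> (2 ^ size s * \rank (fixed s))%N = d.
Proof.
elim: s => [_|c s IH /=/andP[cs us]] /=; first by rewrite mxrank1 mul1n.
rewrite expnSr -mulnA (two_nilpotent_halves (A := spoke c)) ?IH ?edge_nilp_sq ?edge_nilp_spoke //.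
  apply: fixed_stable => b _.
  by rewrite /edge_nilp mulmxDl mulmxDr mul1mx mulmx1 edge_comm.
apply: fixed_stable => b bs; rewrite edge_spoke.
by case: eqP bs cs => [-> ->//|_ _ _]; rewrite raddf0 addr0.
Qed.

Lemma e_fixed s : (e <= fixed s)%MS.
Proof.
elim: s => [|c s IH] /=; first exact: submx1.
rewrite sub_capmx IH; apply/sub_kermxP.
by rewrite /edge_nilp mulmxDr mulmx1 e_fix addmxF2.
Qed.

(* Its rank is at most 2 ^ size s by construction; fixed_rank gives the       *)
(* opposite inequality for the full module.                                   *)
Let spoke_span (s : seq 'I_m) :=
  foldr (fun c Y => (Y + Y *m spoke c)%MS) <<e>>%MS s.

Lemma spoke_span_edge s b : (spoke_span s *m edge b <= spoke_span s)%MS.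
Proof.
elim: s => [|c s IH] /=.
  by rewrite (eqmxMr _ (genmxE _)) e_fix genmxE.
rewrite addsmxMr addsmx_sub (submx_trans IH) ?addsmxSl //=.
rewrite -mulmxA -[spoke c *m _](addmxF2K _ (b == c)%:R%:M) -edge_spoke mulmxDr.
rewrite addmx_sub //.
  by rewrite mulmxA (submx_trans (submxMr _ IH)) ?addsmxSr.
by rewrite mul_mx_scalar scalemx_sub ?addsmxSl.
Qed.

Lemma spoke_span_spoke s b : b \in s -> (spoke_span s *m spoke b <= spoke_span s)%MS.
Proof.
elim: s => //= c s IH; rewrite inE addsmxMr addsmx_sub.
have [-> _|bc /= /IH{}IH] := eqVneq b c.
  by rewrite addsmxSr -mulmxA star_sq ?(left_neq_free l_inj) // mulmx1 addsmxSl.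
rewrite (submx_trans IH) ?addsmxSl //= -mulmxA.
have -> : spoke c *m spoke b = spoke b *m spoke c + 1%:M.
  rewrite -(@star_anti (al c) (al b)) ?(left_neq_free l_inj) ?(left_eq l_inj) 1?eq_sym //.
  by rewrite addrCA addmxF2 addr0.
by rewrite mulmxDr mulmx1 addmx_sub ?addsmxSl // mulmxA
  (submx_trans (submxMr _ IH)) ?addsmxSr.
Qed.

Lemma tr_module (U : 'M['F_2]_d) :
  (forall i j, i != j -> (U *m tr i j <= U)%MS) -> mxmodule rG U.
Proof.
move=> Utr; apply/mxmoduleP=> x _; have [ts -> ts_d] := prod_tpermP x.
elim: ts ts_d => [|[i j] ts IH] /=; first by rewrite big_nil repr_mx1 mulmx1.
case/andP=> ij /IH{}IH; rewrite big_cons repr_in mulmxA.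
by apply: submx_trans IH; apply: submxMr; apply: Utr.
Qed.

Lemma star_module (U : 'M['F_2]_d) :
  (forall i, i != p -> (U *m star i <= U)%MS) -> mxmodule rG U.
Proof.
move=> Ust; have {}Ust i : (U *m star i <= U)%MS.
  by have [->|/Ust//] := eqVneq i p; rewrite /star eqxx mulmx0 sub0mx.
by apply: tr_module => i j ij; rewrite tr_star // mulmxDr addmx_sub.
Qed.

(** The span contains e and is closed under spokes and edges, hence under all stars, since the star
    at the second end of an edge is edge plus spoke. The stars generate the group action. *)
Lemma spoke_span_full : (1%:M <= spoke_span (enum 'I_m))%MS.
Proof.
apply: e_gen.
  apply: star_module => i; have [[[c b]|] ->] := label_surj l_inj i; last by rewrite eqxx.
  move=> _; have Sa : (spoke_span (enum 'I_m) *m spoke c <= spoke_span (enum 'I_m))%MS.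
    by rewrite spoke_span_spoke ?mem_enum.
  case: b => //; have -> : star (be c) = edge c + spoke c by rewrite edgeE addrAC addmxF2 add0r.
  by rewrite mulmxDr addmx_sub ?spoke_span_edge.
elim: (enum _) => [|c s IH] /=; first by rewrite genmxE.
by rewrite (submx_trans IH) ?addsmxSl.
Qed.

Lemma spoke_span_rank s : (\rank (spoke_span s) <= 2 ^ size s)%N.
Proof.
elim: s => [|c s IH] /=; first by rewrite genmxE rank_leq_row.
rewrite (leq_trans (mxrank_adds_leqif _ _)) // expnS mul2n -addnn leq_add //.
exact: leq_trans (mxrankM_maxl _ _) IH.
Qed.

(** 2^m times this rank is d, and d is at most 2^m because the spoke span is everything; the rank is
    positive because e is fixed and nonzero. *)
Lemma spin_rank_fixed : \rank (fixed (enum 'I_m)) = 1%N.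
Proof.
have := fixed_rank (enum_uniq 'I_m); rewrite size_enum_ord => dE.
have := spoke_span_rank (enum 'I_m); rewrite size_enum_ord.
have := mxrankS spoke_span_full; rewrite mxrank1 => le1 /(leq_trans le1).
have F0 : (0 < \rank (fixed (enum 'I_m)))%N.
  rewrite lt0n mxrank_eq0; apply: contraNneq e_neq0 => F0.
  by rewrite -submx0 -F0 e_fixed.
rewrite -[X in (X <= _)%N]dE -[X in (_ <= X)%N]muln1 leq_pmul2l ?expn_gt0 //.
by move=> F1; apply/eqP; rewrite eqn_leq F1.
Qed.

Lemma spin_dimE : d = (2 ^ m)%N.
Proof.
have := fixed_rank (enum_uniq 'I_m).
by rewrite size_enum_ord spin_rank_fixed muln1 => <-.
Qed.

Lemma spin_fixed : (fixed (enum 'I_m) <= e)%MS.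
Proof.
rewrite -(geq_leqif (mxrank_leqif_sup (e_fixed (enum 'I_m)))) spin_rank_fixed.
by rewrite lt0n mxrank_eq0.
Qed.

(** The edges are commuting unipotent involutions, so a nonzero stable [M] contains a nonzero common
    fixed vector: whenever [edge_nilp c] does not kill the part found so far, its image there is
    killed by it. The common fixed space is the line of e, and over F_2 a line has one nonzero
    vector. *)
Lemma e_in_stable k (M : 'M['F_2]_(k, d)) :
  M != 0 -> (forall c, (M *m edge c <= M)%MS) -> (e <= M)%MS.
Proof.
move=> M0 Mv; have: (M :&: fixed (enum 'I_m))%MS != 0.
  elim: (enum _) => [|c s IH] /=; first by rewrite -submx0 (capmx_idPl _) ?submx1 // submx0.
  set M' := (M :&: fixed s)%MS in IH *; rewrite capmxA -/M'.
  have [MN|MN] := eqVneq (M' *m edge_nilp c) 0.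
    by rewrite -submx0 (capmx_idPl _) ?submx0 //; apply/sub_kermxP.
  apply: contraNneq MN => cap0; rewrite -submx0 -cap0 sub_capmx.
  apply/andP; split; last by apply/sub_kermxP; rewrite -mulmxA edge_nilp_sq mulmx0.
  rewrite /edge_nilp mulmxDr mulmx1 addmx_sub //; apply: cap_stable => //.
  by apply: fixed_stable => b _; rewrite edge_comm.
case/rowV0Pn=> w; rewrite sub_capmx => /andP[wM wF] w0.
apply: submx_trans wM; have := submx_trans wF spin_fixed.
case/sub_rVP=> x wE; case: (F2_cases x) wE => -> wE; last by rewrite wE scale1r.
by rewrite wE scale0r eqxx in w0.
Qed.

Local Notation H := (point_stabilizer p).
Local Notation N := (jm rG p).

Lemma stabP (x : 'S_n) : reflect (x p = p) (x \in H).
Proof. by rewrite !inE sub1set inE; apply: eqP. Qed.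

Lemma label_sum (F : 'I_n -> 'M['F_2]_d) :
  \sum_(i | i != p) F i = \sum_c (F (al c) + F (be c)).
Proof.
have := big_label l_inj +%R F; rewrite (bigD1 p) //=; exact: addrI.
Qed.

Lemma jmE : N = \sum_c edge c + m%:R%:M.
Proof.
rewrite /jm label_sum; congr (_ + _); apply: eq_bigr => c _.
by rewrite edgeE /star (negPf (left_neq_free l_inj c)) (negPf (right_neq_free l_inj c)).
Qed.

Lemma jm_conj x : rG x^-1%g *m N *m rG x = jm rG (x p).
Proof.
rewrite /jm mulmxDr mulmxDl.
have -> : rG x^-1%g *m m%:R%:M *m rG x = m%:R%:M.
  by rewrite scalar_mxC -mulmxA -repr_in mulVg repr_mx1 mulmx1.
congr (_ + _); rewrite mulmx_sumr mulmx_suml [RHS](reindex_inj (@perm_inj _ x)) /=.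
by apply: eq_big => i; [rewrite (inj_eq perm_inj) | move=> _; rewrite tr_conj].
Qed.

Lemma kermx_jm_conj x : (kermx N *m rG x :=: kermx (jm rG (x p)))%MS.
Proof.
have Gx := in_setT x; apply/eqmxP/andP; split.
  apply/sub_kermxP; rewrite -jm_conj !mulmxA.
  by rewrite repr_mxK // mulmx_ker mul0mx.
rewrite -[X in (X <= _)%MS](repr_mxKV rG Gx); apply: submxMr.
apply/sub_kermxP; rewrite -mulmxA.
have -> : rG x^-1%g *m N = jm rG (x p) *m rG x^-1%g.
  by rewrite -jm_conj repr_mxK.
by rewrite mulmxA mulmx_ker mul0mx.
Qed.

Lemma jm_stab x : x \in H -> rG x *m N = N *m rG x.
Proof.
move/stabP=> xp; have := jm_conj x; rewrite xp => E.
rewrite -{1}E !mulmxA.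
by rewrite -repr_in mulgV repr_mx1 mul1mx.
Qed.

(** By [jmE], N is m plus a sum of m commuting involutions. In characteristic 2 its square is m +
    m^2 = 0. *)
Lemma jm_sqr0 : N *m N = 0.
Proof.
have vs (s : seq 'I_m) :
    (\sum_(c <- s) edge c) *m (\sum_(c <- s) edge c) = (size s)%:R%:M.
  elim: s => [|c s IH]; first by rewrite !big_nil mul0mx raddf0.
  rewrite !big_cons mulmxDl !mulmxDr IH edge_sq.
  have -> : (\sum_(c <- s) edge c) *m edge c = edge c *m (\sum_(c <- s) edge c).
    by rewrite mulmx_sumr mulmx_suml; apply: eq_bigr => b _; rewrite edge_comm.
  by rewrite addrA addmxF2K -raddfD /= -natr1 addrC.
rewrite jmE mulmxDl !mulmxDr vs -scalar_mxM -natrM.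
rewrite [in X in _ + X + _]scalar_mxC addrA addmxF2K.
rewrite -raddfD -natrD /=.
have -> : size (index_enum 'I_m) = m.
  by rewrite -[RHS]size_enum_ord enumT.
by case: (F2_cases m%:R) => mE; rewrite natrD natrM mE ?mul0r ?mul1r addF2 raddf0.
Qed.

Lemma jm_star (c : 'I_m) : N *m spoke c + spoke c *m N = 1%:M.
Proof.
rewrite jmE mulmxDl mulmxDr addrACA scalar_mxC addmxF2 addr0.
rewrite mulmx_suml mulmx_sumr -big_split (bigD1 c) //= edge_spoke_anti eqxx.
by rewrite big1 ?addr0 // => b /negPf bc; rewrite edge_spoke_anti bc raddf0.
Qed.

Lemma e_jm : e *m N = 0.
Proof.
rewrite jmE mulmxDr mulmx_sumr (eq_bigr (fun=> e)) => [|c _]; last exact: e_fix.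
by rewrite sumr_const card_ord mul_mx_scalar scaler_nat addmxF2.
Qed.

Lemma jm_kermx_rank : (0 < m)%N -> (2 * \rank (kermx N))%N = d.
Proof.
move=> m0; rewrite -(cap1mx (kermx N)) -[RHS](mxrank1 'F_2).
by apply: two_nilpotent_halves (jm_sqr0) (jm_star (Ordinal m0)); rewrite submx1.
Qed.

Let stab_span := (\sum_(h in H) <<e *m rG h>>)%MS.

Lemma e_stab_span : (e <= stab_span)%MS.
Proof. by rewrite (sumsmx_sup 1%g) ?group1 // repr_mx1 mulmx1 genmxE. Qed.

Lemma stab_span_stable x : x \in H -> (stab_span *m rG x <= stab_span)%MS.
Proof.
move=> Hx; rewrite sumsmxMr; apply/sumsmx_subP=> h Hh.
rewrite (eqmxMr _ (genmxE _)) -mulmxA -repr_in.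
by rewrite (sumsmx_sup (h * x)%g) ?groupM // genmxE.
Qed.

(** The edges avoid the unmatched point, so they lie in the stabilizer and [e_in_stable] applies. *)
Lemma stab_span_min k (M : 'M['F_2]_(k, d)) : M != 0 ->
  (forall h, h \in H -> (M *m rG h <= M)%MS) -> (stab_span <= M)%MS.
Proof.
move=> M0 MH; apply/sumsmx_subP=> h Hh; rewrite genmxE.
apply: submx_trans (MH h Hh); apply: submxMr; apply: e_in_stable => // c.
by apply: MH; apply/stabP; rewrite tpermD ?left_neq_free ?right_neq_free.
Qed.

(** N kills e and commutes with the stabilizer, which gives one inclusion. Equality follows because
    the rank of the span is at least d/2. *)
Lemma stab_span_jm : (0 < m)%N -> (stab_span :=: kermx N)%MS.
Proof.
move=> m0; apply/eqmxP; rewrite -(geq_leqif (mxrank_leqif_eq _)).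
  rewrite -(leq_pmul2l (isT : 0 < 2)%N) jm_kermx_rank // mul2n -addnn.
  (* One star outside the stabilizer suffices: any other star differs from [a0] by a transposition
     fixing [p], and the Clifford relation moves it past [a0]. So [W] is a submodule containing e,
     hence everything. *)
  pose a0 := spoke (Ordinal m0); set W := (stab_span + stab_span *m a0)%MS.
  have Wa : (W *m a0 <= W)%MS.
    by rewrite addsmxMr addsmx_sub addsmxSr -mulmxA star_sq ?left_neq_free // mulmx1 addsmxSl.
  have Ystar i : i != p -> (stab_span *m star i <= W)%MS.
    move=> ip; have [->|ic] := eqVneq i (al (Ordinal m0)); first exact: addsmxSr.
    rewrite -[star i](addmxF2K _ a0) -tr_star // mulmxDr addmx_sub ?addsmxSr //.
    apply: submx_trans (addsmxSl _ _); apply/stab_span_stable/stabP.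
    by rewrite tpermD ?left_neq_free.
  have Wmod : mxmodule rG W.
    apply: star_module => i ip; rewrite addsmxMr addsmx_sub Ystar //=.
    have [->|ic] := eqVneq i (al (Ordinal m0)).
      by rewrite -mulmxA star_sq ?left_neq_free // mulmx1 addsmxSl.
    have -> : stab_span *m a0 *m star i = stab_span *m star i *m a0 + stab_span.
      rewrite -!mulmxA -[X in _ + X]mulmx1 -mulmxDr; congr (stab_span *m _).
      by rewrite -(@star_anti i (al (Ordinal m0))) ?left_neq_free // addrA addmxF2 add0r.
    by rewrite addmx_sub ?addsmxSl // (submx_trans (submxMr _ (Ystar i ip))).
  have := mxrankS (e_gen Wmod (submx_trans e_stab_span (addsmxSl _ _))).
  rewrite mxrank1 => /leq_trans-> //.
  rewrite (leq_trans (mxrank_adds_leqif _ _)) // leq_add2l mxrankM_maxl.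
  by [].
apply/sumsmx_subP=> h Hh; rewrite genmxE; apply/sub_kermxP.
by rewrite -mulmxA jm_stab // mulmxA e_jm mul0mx.
Qed.

Lemma stab_span_rank : (0 < m)%N -> \rank stab_span = (2 ^ (m - 1))%N.
Proof.
move=> m0; apply/eqP; rewrite -(eqn_pmul2l (isT : 0 < 2)%N).
by rewrite stab_span_jm // jm_kermx_rank // spin_dimE -expnS subn1 prednK.
Qed.

(** By [stab_span_min] this span lies in every nonzero submodule of the restriction, so it is the
    unique simple one. *)
Lemma stab_span_socle : (0 < m)%N ->
  (restriction_socle rG (subsetT H) :=: stab_span)%MS.
Proof.
move=> m0; set sG := subg_repr rG (subsetT H).
have modP k (M : 'M_(k, d)) : mxmodule sG M -> forall h, h \in H -> (M *m rG h <= M)%MS.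
  by move/mxmoduleP.
have simY : mxsimple sG stab_span.
  split; first by apply/mxmoduleP=> x /stab_span_stable.
    by apply: contraNneq e_neq0 => Y0; rewrite -submx0 -Y0 e_stab_span.
  by move=> U /modP UH _ U0; apply: stab_span_min.
apply/eqmxP/andP; split; last exact: simple_Socle.
have [I M /= simM <- _] := Socle_semisimple (DecSocleType sG).
apply/sumsmx_subP=> i _; have [modM M0 minM] := simM i.
apply: minM; [exact: mxsimple_module | exact/stab_span_min/modP | by case: simY].
Qed.

(** The scalars and the two copies of (qr) cancel. Each of the remaining 2m-1 points i contributes
    (iq)+(ir) = (qr), and 2m-1 is odd. *)
Lemma jm_add q r : q != r -> jm rG q + jm rG r = tr q r.
Proof.
move=> qr; rewrite /jm addrACA addmxF2 addr0.
rewrite (bigD1 r) 1?eq_sym //= [X in _ + X](bigD1 q) //= addrACA.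
rewrite (trC r q) addmxF2 add0r.
rewrite [X in _ + X](eq_bigl (fun i => (i != q) && (i != r))); last first.
  by move=> i; rewrite andbC.
rewrite -big_split /= (eq_bigr (fun=> tr q r)) => [|i /andP[iq ir]]; last first.
  by apply: addmxF2_eq; rewrite (trC i q) tr3 // eq_sym.
rewrite sumr_const.
have -> : #|[pred i | (i != q) && (i != r)]| = (2 * m).-1.
  have := cardC [set q; r]; rewrite cards2 qr card_ord => /(canRL (addKn _)).
  rewrite subSS subn1 => <-; apply: eq_card => i.
  by rewrite !inE negb_or.
have m0 : (0 < m)%N.
  rewrite lt0n; apply: contraNneq qr => m0; have e0 : (2 * m <= 0)%N by rewrite m0.
  have z (i : 'I_n) : i = 0%N :> nat.
    by apply/eqP; rewrite -leqn0 (leq_trans _ e0) // -ltnS.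
  by apply/eqP/val_inj; rewrite /= !z.
have -> : (2 * m).-1 = (2 * m.-1).+1 by rewrite -[in LHS](prednK m0) mulnS.
by rewrite mulrS mulrnA mulr2n addmxF2 mul0rn addr0.
Qed.

(** On the intersection the invertible operator (qr), the sum of the two nilpotent ones, acts as
    0. *)
Lemma kermx_jm_cap q r : q != r ->
  (kermx (jm rG q) :&: kermx (jm rG r) :=: (0 : 'M_d))%MS.
Proof.
move=> qr; apply/eqmxP; rewrite sub0mx andbT; apply/rV_subP=> w.
rewrite sub_capmx => /andP[/sub_kermxP wq /sub_kermxP wr]; rewrite submx0.
have : w *m tr q r = 0 by rewrite -jm_add // mulmxDr wq wr addr0.
by move/(congr1 (mulmx^~ (tr q r))); rewrite -mulmxA tr_sq mulmx1 mul0mx => ->.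
Qed.

End Spin.

(** * Sections of a representation *)

Section SectionModule.

Variables (F : fieldType) (gT : finGroupType) (G : {group gT}) (n : nat).
Variables (rG : mx_representation F G n) (U V : 'M[F]_n).
Hypotheses (modU : mxmodule rG U) (modV : mxmodule rG V) (sUV : (U <= V)%MS).
Local Notation W := <<in_factmod U V>>%MS.
Local Notation sG := (section_repr modU modV).

Definition to_section (x : 'rV[F]_n) : 'rV_(\rank W) :=
  in_submod W (in_factmod U x).
(** A linear splitting of [to_section], with no equivariance claimed; vectors of V are recovered
    from it modulo U ([to_sectionK]). *)
Definition of_section (v : 'rV_(\rank W)) : 'rV[F]_n :=
  val_factmod (val_submod v).

HB.instance Definition _ := GRing.Linear.copy to_section
  (in_submod W \o @in_factmod _ _ U 1).
HB.instance Definition _ := GRing.Linear.copy of_section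
  (@val_factmod _ _ U 1 \o @val_submod _ _ W 1).

Lemma to_sectionD x y : to_section (x + y) = to_section x + to_section y.
Proof. exact: linearD. Qed.

Lemma of_sectionD v w : of_section (v + w) = of_section v + of_section w.
Proof. exact: linearD. Qed.

Lemma of_sectionZ a v : of_section (a *: v) = a *: of_section v.
Proof. exact: linearZ. Qed.

Lemma of_section_sub v : (of_section v <= V)%MS.
Proof.
apply: (submx_trans (B := val_factmod (in_factmod U V))).
  by rewrite val_factmodS (submx_trans (val_submodP _)) ?genmxE.
by apply: submx_trans (proj_factmodS _ _) _; rewrite addsmx_sub sUV submx_refl.
Qed.

Lemma of_sectionK v : to_section (of_section v) = v.
Proof. by rewrite /to_section val_factmodK val_submodK. Qed.

Lemma in_factmod_sub (x : 'rV_n) : (x <= V)%MS -> (in_factmod U x <= W)%MS.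
Proof. by move=> xV; rewrite genmxE submxMr. Qed.

Lemma to_section_eq0 x : (x <= V)%MS -> (to_section x == 0) = (x <= U)%MS.
Proof.
move=> xV; rewrite -(in_factmod_eq0 U x) -(val_submod_eq0 (to_section x)).
by rewrite in_submodK ?in_factmod_sub.
Qed.

Lemma to_sectionJ x g : (x <= V)%MS -> g \in G ->
  to_section (x *m rG g) = to_section x *m sG g.
Proof.
move=> xV Gg; rewrite /to_section in_factmodJ //.
exact: (in_submodJ (section_module modU modV)) (in_factmod_sub xV).
Qed.

Lemma to_sectionK x : (x <= V)%MS -> (x - of_section (to_section x) <= U)%MS.
Proof.
move=> xV; rewrite -to_section_eq0 ?linearB /= ?of_sectionK ?subrr //.
by rewrite addmx_sub // eqmx_opp of_section_sub.
Qed.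

Lemma section_rank : (\rank W + \rank U)%N = \rank V.
Proof. by rewrite genmxE mxrank_in_factmod (addsmx_idPr sUV). Qed.

Lemma section_gen (x : 'rV_n) k (M : 'M_(k, \rank W)) : (x <= V)%MS ->
    (V <= \sum_(g in G) <<x *m rG g>>)%MS ->
    mxmodule sG M -> (to_section x <= M)%MS ->
  (1%:M <= M)%MS.
Proof.
move=> xV Vx modM xM; apply/row_subP=> i; rewrite -[row i _]of_sectionK.
have /sub_sumsmxP[u ->] := submx_trans (of_section_sub (row i 1%:M)) Vx.
rewrite linear_sum summx_sub // => g Gg.
have : (u g *m <<x *m rG g>>%MS <= x *m rG g)%MS by rewrite mulmx_sub ?genmxE.
case/sub_rVP=> a ->; rewrite linearZ /= scalemx_sub // to_sectionJ //.
exact: submx_trans (submxMr _ xM) (mxmoduleP modM g Gg).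
Qed.

End SectionModule.

(** * Polytabloids of shape (m+1, m) *)

Section SpechtCoordinates.

Variable m : nat.
Local Notation n := (2 * m).+1.
Local Notation la := [:: m.+1; m].
Local Notation lab := (label m -> 'I_n).
Local Notation bits := {ffun 'I_n -> bool}.
Local Notation al l c := (l (Some (c, false))).
Local Notation be l c := (l (Some (c, true))).

(** Edges of the matching are the columns of length 2; the unmatched point sits in the single column
    of length 1, at the end of the first row. *)
Definition cell_of (k : label m) : cell la :=
  match k with
  | None => existT _ (ord0 : 'I_2) (ord_max : 'I_m.+1)
  | Some (c, false) =>
      existT _ (ord0 : 'I_2) (widen_ord (leqnSn m) c)
  | Some (c, true) =>
      existT _ (ord_max : 'I_2) c
  end.

Lemma cell_of_col k :
  cell_col (cell_of k) = if k is Some (c, _) then c : nat else m.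
Proof. by case: k => [[c []]|]. Qed.

Lemma cell_of_row k :
  cell_row (cell_of k) = (if k is Some (_, b) then b : nat else 0%N) :> nat.
Proof. by case: k => [[c []]|]. Qed.

Lemma cell_of_inj : injective cell_of.
Proof.
move=> k k' E; have := cell_of_col k; have := cell_of_row k.
rewrite E cell_of_row cell_of_col.
case: k k' {E} => [[c b]|] [[c' b']|] //.
- by move=> bb /val_inj->; case: b b' bb => [] [].
- by move=> _ cm; have := ltn_ord c; rewrite -cm ltnn.
- by move=> _ cm; have := ltn_ord c'; rewrite cm ltnn.
Qed.

Lemma card_cell : #|cell la| = n.
Proof.
rewrite card_tagged sumnE big_map big_enum /= !big_ord_recl big_ord0 /= !card_ord.
by rewrite addn0 mulSn mul1n addSn.
Qed.

Lemma cell_of_bij : bijective cell_of.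
Proof.
apply: inj_card_bij cell_of_inj _.
by rewrite card_cell card_option card_prod card_bool card_ord mulnC.
Qed.

Definition wt (f : bits) : nat := (\sum_i f i)%N.

(* The indicator function of the second row. *)
Definition conf (T : tabloid n la) : bits := [ffun x => (0 < val T x)%N].

Lemma confE (T : tabloid n la) x : val T x = conf T x :> nat.
Proof. by rewrite ffunE; case: (val T x) => [[|[|]]]. Qed.

Lemma conf_inj : injective conf.
Proof.
move=> T T' E; apply/val_inj/ffunP=> x; apply: val_inj.
by rewrite /= !confE E.
Qed.

Lemma conf_wt (T : tabloid n la) : wt (conf T) = m.
Proof.
have := forallP (valP T) ord_max => /eqP /= <-.
rewrite /wt -sum1dep_card [RHS]big_mkcond; apply: eq_bigr => x _.
rewrite ffunE -val_eqE /=.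
by case: (val T x) => [[|[|]]].
Qed.

Lemma conf_surj (f : bits) : wt f = m -> exists T, conf T = f.
Proof.
move=> fm; pose g : {ffun 'I_n -> 'I_(size la)} :=
  [ffun x => if f x then ord_max : 'I_2 else ord0 : 'I_2].
have gE x : g x = if f x then ord_max : 'I_2 else ord0 : 'I_2 by rewrite ffunE.
have g1 : #|[set x | g x == ord_max]| = m.
  rewrite -[RHS]fm /wt -sum1dep_card big_mkcond; apply: eq_bigr => x _.
  by rewrite gE; case: (f x).
have gt : is_tabloid g.
  apply/forallP=> -[[|[|//]] hi]; apply/eqP.
    have -> : [set x | g x == Ordinal hi] = ~: [set x | g x == ord_max].
      by apply/setP=> x; rewrite !inE gE; case: (f x).
    have := cardsC [set x | g x == ord_max]; rewrite g1 card_ord /= => E.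
    by apply: (@addnI m); rewrite E mulSn mul1n addnS.
  by rewrite /= -[RHS]g1; apply: eq_card => x; rewrite !inE.
exists (Sub g gt); apply/ffunP=> x; by rewrite ffunE /= gE; case: (f x).
Qed.

Lemma big_conf (R : nmodType) (F : bits -> R) :
  \sum_(j < #|{: tabloid n la}|) F (conf (enum_val j)) = \sum_(f | wt f == m) F f.
Proof.
have <- : \sum_(T : tabloid n la) F (conf T) = \sum_(f | wt f == m) F f.
  rewrite -(big_imset F (in2W conf_inj)); apply: eq_bigl => f.
  apply/imsetP/eqP=> [[T _ ->]|/conf_surj[T <-]]; [exact: conf_wt | by exists T].
by rewrite [RHS](reindex _ (onW_bij _ (enum_val_bij _))).
Qed.

Definition crossing (l : lab) (f : bits) : bool :=
  [forall c, f (al l c) != f (be l c)].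

Lemma crossing_wt (l : lab) f : injective l -> crossing l f ->
  wt f = (f (l None) + m)%N.
Proof.
move=> lI /forallP lf; rewrite /wt (big_label lI addn (fun i => f i : nat)) /=.
congr (_ + _)%N; rewrite (eq_bigr (fun=> 1%N)) ?sum1_card ?card_ord // => c _.
by have := lf c; case: (f _) => /=; case: (f _).
Qed.

Definition pt (l : lab) : 'rV['F_2]_#|{: tabloid n la}| :=
  \row_j (crossing l (conf (enum_val j)))%:R.

(** Signs are trivial mod 2, so each coefficient counts column permutations producing a given
    tabloid. There is one if the second row crosses every edge, and none otherwise. *)
Lemma polytabloid_pt (t : {ffun 'I_n -> cell la}) (l : lab) :
  injective l -> (forall k, t (l k) = cell_of k) -> polytabloid 'F_2 t = pt l.
Proof.
move=> lI tl; have tI : injective t.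
  move=> x y; have [k ->] := label_surj lI x; have [k' ->] := label_surj lI y.
  by rewrite !tl => /cell_of_inj->.
apply/rowP=> j; rewrite !mxE; set T := enum_val j; set f := conf T.
rewrite (eq_bigr (fun=> 1)) => [|s _]; last first.
  by have -> : -1 = 1 :> 'F_2; [apply: val_inj | rewrite expr1n].
pose P s := (s \in column_stabilizer t) && (row_act (tableau_rows t) s == val T).
have PP s : P s -> forall x, cell_col (t (s^-1%g x)) = cell_col (t x)
                        /\ cell_row (t (s^-1%g x)) = f x :> nat.
  case/andP; rewrite inE => /forallP col /eqP/ffunP row x; split.
    by have := col (s^-1%g x); rewrite permKV => /eqP.
  by rewrite -confE -row !ffunE.
have t_eq x y : cell_col (t x) = cell_col (t y) ->
    cell_row (t x) = cell_row (t y) :> nat -> x = y.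
  have [k ->] := label_surj lI x; have [k' ->] := label_surj lI y.
  rewrite !tl !cell_of_col !cell_of_row.
  case: k k' => [[c b]|] [[c' b']|] //.
  - by move=> /val_inj-> bb; case: b b' bb => [] [].
  - by move=> cm; have := ltn_ord c; rewrite cm ltnn.
  - by move=> cm; have := ltn_ord c'; rewrite -cm ltnn.
rewrite -/(P _) sumr_const; case: (boolP (crossing l f)) => [lf | ]; last first.
  case/forallPn=> c; rewrite negbK => /eqP fc.
  rewrite eq_card0 // => s; apply/negP=> /PP Ps.
  have [cola rowa] := Ps (al l c); have [colb rowb] := Ps (be l c).
  have : s^-1%g (al l c) = s^-1%g (be l c).
    apply: t_eq; last by rewrite rowa rowb fc.
    by rewrite cola colb !tl !cell_of_col.
  by move/perm_inj/lI.
have fp : f (l None) = false.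
  have := crossing_wt lI lf; rewrite conf_wt; case: (f _) => // /eqP.
  by rewrite add1n eqn_leq ltnn andbF.
(* The permutation is forced: inside each column an entry goes to the row prescribed by [f]. *)
pose r (k : label m) : label m := if k is Some (c, b) then Some (c, f (l k)) else None.
have rI : injective r.
  move=> [[c b]|] [[c' b']|] //= [<-].
  have := forallP lf c; case: b b' => [] [] //= ne E; rewrite E ?eqxx // in ne.
have [g lK Kl] := label_bij lI.
have wI : injective (l \o r \o g).
  by apply: inj_comp (can_inj Kl); apply: inj_comp.
pose q := perm wI.
have qE k : q (l k) = l (r k) by rewrite permE /= lK.
rewrite (eq_card1 (x := q^-1%g)) // => s; apply/idP/eqP=> [/PP Ps | ->].
  apply: invg_inj; rewrite invgK; apply/permP=> x; have [col row] := Ps x.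
  have [k xE] := label_surj lI x.
  apply: t_eq; rewrite ?col ?row xE qE !tl ?cell_of_col ?cell_of_row.
    by case: (k) => [[c b]|].
  by case: (k) => [[c b]|] //=; rewrite fp.
apply/andP; split.
  rewrite inE; apply/forallP=> x; apply/eqP; rewrite -(permKV q x).
  have [k ->] := label_surj lI (q^-1%g x); rewrite permK qE !tl !cell_of_col.
  by case: (k) => [[c b]|].
apply/eqP/ffunP=> x; rewrite !ffunE invgK; apply: val_inj; rewrite /= confE -/f.
have [k ->] := label_surj lI x; rewrite qE tl cell_of_row.
by case: (k) => [[c b]|] //=; rewrite fp.
Qed.

Lemma tableau_label (t : {ffun 'I_n -> cell la}) : is_tableau t ->
  exists2 l : lab, injective l & polytabloid 'F_2 t = pt l.
Proof.
case/andP=> /injectiveP tI /forallP tS.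
pose l k := iinv (tS (cell_of k)).
have tl k : t (l k) = cell_of k by rewrite f_iinv.
have lI : injective l by move=> k k' E; apply: cell_of_inj; rewrite -!tl E.
by exists l => //; apply: polytabloid_pt.
Qed.

Lemma label_tableau (l : lab) : injective l ->
  exists2 t : {ffun 'I_n -> cell la}, is_tableau t & polytabloid 'F_2 t = pt l.
Proof.
move=> lI; have [g lK Kl] := label_bij lI.
pose t := [ffun x => cell_of (g x)]; have tl k : t (l k) = cell_of k.
  by rewrite ffunE lK.
exists t; last exact: polytabloid_pt.
apply/andP; split.
  by apply/injectiveP=> x y; rewrite !ffunE => /cell_of_inj/(can_inj Kl).
have [h _ Kh] := cell_of_bij.
by apply/forallP=> c; apply/codomP; exists (l (h c)); rewrite tl Kh.
Qed.

Lemma conf_act T (g : 'S_n) x : conf (tabloid_act T g) x = conf T (g^-1%g x).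
Proof.
have E : val (tabloid_act T g) x = val T (g^-1%g x) by exact: ffunE.
by rewrite [LHS]ffunE [RHS]ffunE E.
Qed.

Lemma pt_act (l : lab) (g : 'S_n) : pt l *m tabloid_mx 'F_2 la g = pt (g \o l).
Proof.
rewrite mul_tabloid_mx; apply/rowP=> j; rewrite !mxE enum_rankK.
congr (nat_of_bool _)%:R; apply: eq_forallb => c.
by rewrite !conf_act !invgK.
Qed.

Lemma pt_specht l : injective l -> (pt l <= specht 'F_2 n la)%MS.
Proof.
by case/label_tableau=> t tab <-; rewrite (sumsmx_sup t) ?genmxE.
Qed.

Lemma label_perm (l l' : lab) : injective l -> injective l' ->
  exists g : 'S_n, l' =1 g \o l.
Proof.
move=> lI lI'; have [g lK Kl] := label_bij lI.
have wI : injective (l' \o g) by apply: inj_comp (can_inj Kl).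
by exists (perm wI) => k; rewrite /= permE /= lK.
Qed.

Lemma eq_pt (l l' : lab) : l =1 l' -> pt l = pt l'.
Proof.
move=> E; apply/rowP=> j; rewrite !mxE; congr (nat_of_bool _)%:R.
by apply: eq_forallb => c; rewrite !E.
Qed.

Lemma specht_gen l : injective l ->
  (specht 'F_2 n la <= \sum_(g in [set: 'S_n]) <<pt l *m tabloid_repr 'F_2 n la g>>)%MS.
Proof.
move=> lI; apply/sumsmx_subP=> t /tableau_label[l' lI' ->]; rewrite genmxE.
have [g lg] := label_perm lI lI'.
by rewrite (sumsmx_sup g) ?in_setT // genmxE [_ g]/= pt_act (eq_pt lg).
Qed.

End SpechtCoordinates.

(** * The relation (ij) + (jk) + (ik) = 0 modulo the radical *)

Lemma sum_involution (T : finType) (P : pred T) (F : T -> 'F_2) (phi : T -> T) :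
    involutive phi -> (forall x, P x -> phi x != x) ->
    (forall x, P (phi x) = P x) -> (forall x, P x -> F (phi x) = F x) ->
  \sum_(x | P x) F x = 0.
Proof.
move=> phiK phi_neq Pphi Fphi.
(* Selects one element from each two-element orbit of [phi]. *)
pose lt x := (enum_rank x < enum_rank (phi x))%N.
rewrite (bigID lt) /= [X in _ + X](reindex_inj (inv_inj phiK)) /=.
rewrite [X in _ + X](_ : _ = \sum_(x | P x && lt x) F x) ?addF2 //.
apply: eq_big => [x|x /andP[]]; last by rewrite Pphi => /Fphi.
rewrite Pphi /lt phiK -leqNgt leq_eqVlt; case Px: (P x) => //=.
case: eqVneq => //= /val_inj/enum_rank_inj E.
by have := phi_neq x Px; rewrite -E eqxx.
Qed.

Section LocalRelation.

Variable m : nat.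
Local Notation config := (label m -> bool).
Implicit Types (h : config) (s : seq 'I_m) (k : label m).

Definition split_edge h c := h (Some (c, false)) != h (Some (c, true)).

Definition split_off s h := [forall c, (c \in s) || split_edge h c].

(** The coefficient mod 2, at the configuration [h], of the image of a polytabloid under the sum of
    the three transpositions, in the labels of its own matching. *)
Definition triple_sum k1 k2 k3 h : bool :=
  [forall c, split_edge (h \o tperm k1 k2) c] (+)
  [forall c, split_edge (h \o tperm k2 k3) c] (+)
  [forall c, split_edge (h \o tperm k1 k3) c].

Definition config_wt h : nat :=
  (h None + \sum_c (h (Some (c, false)) + h (Some (c, true))))%N.

Lemma split_edgeE h c b : split_edge h c = (h (Some (c, b)) != h (Some (c, ~~ b))).
Proof. by case: b => //; rewrite eq_sym. Qed.

Lemma split_offE s h :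
  [forall c, split_edge h c] = split_off s h && all (split_edge h) s.
Proof.
apply/forallP/andP=> [H|[/forallP H /allP Hs] c].
  by split; [apply/forallP=> c; rewrite H orbT | apply/allP].
by case/orP: (H c) => // /Hs.
Qed.

Lemma split_off_tperm s h k k' :
    (forall c b, c \notin s -> (k != Some (c, b)) && (k' != Some (c, b))) ->
  split_off s (h \o tperm k k') = split_off s h.
Proof.
move=> ks; apply: eq_forallb => c; case: (boolP (c \in s)) => //= cs.
have /andP[k1 k1'] := ks c false cs; have /andP[k2 k2'] := ks c true cs.
by rewrite /split_edge /= !tpermD.
Qed.

(* Every edge outside s contributes 1 to the weight. *)
Lemma split_off_wt s h : uniq s -> split_off s h -> config_wt h = m ->
  (h None + \sum_(c <- s) (h (Some (c, false)) + h (Some (c, true))))%N = size s.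
Proof.
move=> us /forallP hs; rewrite /config_wt (bigID (mem s)) /= addnA.
rewrite [X in (_ + X)%N](eq_bigr (fun=> 1%N)) => [|c]; last first.
  by move/negPf=> cs; have := hs c; rewrite cs /split_edge; do 2!case: (h _).
rewrite sum1_card -big_uniq // -(card_uniqP us) => wt_h.
by apply: (@addIn #|[predC s]|); rewrite cardC card_ord.
Qed.

(* In the second case the sum over all configurations of weight m vanishes,   *)
(* since few enough linear conditions are imposed on h (see common_kernel).   *)
Definition local_relation k1 k2 k3 : Prop :=
  (forall h, ~~ triple_sum k1 k2 k3 h) \/
  exists s (phi : bool -> bool), [/\ uniq s, (2 <= size s)%N &
    forall h, config_wt h = m ->
      triple_sum k1 k2 k3 h = split_off s h && phi (h None)].

Lemma local_relation_rot k1 k2 k3 :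
  local_relation k1 k2 k3 -> local_relation k2 k3 k1.
Proof.
have E h : triple_sum k2 k3 k1 h = triple_sum k1 k2 k3 h.
  by rewrite /triple_sum (tpermC k3 k1) (tpermC k2 k1) addbC addbA.
case=> [T0|[s [phi [us s2 T]]]]; [left=> h | right; exists s, phi; split=> // h].
  by rewrite E.
by rewrite E => /T.
Qed.

Let opt_eq (c c' : 'I_m) b b' :
  (Some (c, b) == Some (c', b') :> label m) = (c == c') && (b == b').
Proof. by rewrite (inj_eq Some_inj) xpair_eqE. Qed.

Let neqb b : (~~ b == b) = false. Proof. by case: b. Qed.
Let neqb' b : (b == ~~ b) = false. Proof. by case: b. Qed.

(** If [k] lies on another edge, the three summands carry the three perfect matchings of four
    points, and any set of points crosses none or two of them. If [k] is the unmatched point, the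
    three edges form a triangle, of which any set splits none or two sides. *)
Lemma local_relation_edge c b k : k != Some (c, b) -> k != Some (c, ~~ b) ->
  local_relation (Some (c, b)) (Some (c, ~~ b)) k.
Proof.
case: k => [[c' b']|] kb kb'; left=> h; rewrite /triple_sum.
  have cc : (c == c') = false.
    apply/eqP=> cc; rewrite cc !opt_eq eqxx /= in kb kb'.
    by case: b b' kb kb' => [] [].
  have cc' : (c' == c) = false by rewrite eq_sym.
  rewrite !(split_offE [:: c; c']) !split_off_tperm; first last.
  - move=> d b''; rewrite !inE negb_or => /andP[/negPf dc /negPf dc'].
    by rewrite !opt_eq ![_ == d]eq_sym ?dc ?dc'.
  - move=> d b''; rewrite !inE negb_or => /andP[/negPf dc /negPf dc'].
    by rewrite !opt_eq ![_ == d]eq_sym ?dc ?dc'.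
  - move=> d b''; rewrite !inE negb_or => /andP[/negPf dc /negPf dc'].
    by rewrite !opt_eq ![_ == d]eq_sym ?dc ?dc'.
  rewrite /= !(split_edgeE _ c b) !(split_edgeE _ c' b') /= !permE /=.
  rewrite !opt_eq !eqxx ?neqb ?neqb' ?cc ?cc' /=.
  case: (split_off _ _) => //=.
  by move: (h (Some (c, b))) (h (Some (c, ~~ b)))
    (h (Some (c', b'))) (h (Some (c', ~~ b'))) => [] [] [] [].
rewrite !(split_offE [:: c]) !split_off_tperm; first last.
- by move=> d b'; rewrite !inE !opt_eq eq_sym => /negPf->.
- by move=> d b'; rewrite !inE !opt_eq eq_sym => /negPf->.
- by move=> d b'; rewrite !inE !opt_eq eq_sym => /negPf->.
rewrite /= !(split_edgeE _ c b) /= !permE /=.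
rewrite !opt_eq !eqxx ?neqb ?neqb' /=.
case: (split_off _ _) => //=.
by move: (h (Some (c, b))) (h (Some (c, ~~ b))) (h None) => [] [] [].
Qed.

Lemma local_relation_none c b c' b' : c != c' ->
  local_relation (Some (c, b)) (Some (c', b')) None.
Proof.
move=> ncc; right; exists [:: c; c'], (fun=> true); split=> //=.
  by rewrite inE ncc.
have cc := negPf ncc; have cc' : (c' == c) = false by rewrite eq_sym.
move=> h wt_h; rewrite /triple_sum.
have out (d : 'I_m) b'' : d \notin [:: c; c'] ->
    (Some (c, b) != Some (d, b'') :> label m) && (Some (c', b') != Some (d, b'') :> label m).
  by rewrite !inE negb_or => /andP[/negPf dc /negPf dc']; rewrite !opt_eq ![_ == d]eq_sym ?dc ?dc'.
rewrite !(split_offE [:: c; c']) !split_off_tperm; first last.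
- by move=> d b'' /(out _ b'')/andP[o1 o2]; rewrite ?o1 ?o2.
- by move=> d b'' /(out _ b'')/andP[o1 o2]; rewrite ?o1 ?o2.
- by move=> d b'' /(out _ b'')/andP[o1 o2]; rewrite ?o1 ?o2.
case: (boolP (split_off _ _)) => [hs|_]; last by [].
have := split_off_wt _ hs wt_h; rewrite /= inE ncc => /(_ isT).
have sumb (x : 'I_m) y : (h (Some (x, false)) + h (Some (x, true)) =
    h (Some (x, y)) + h (Some (x, ~~ y)))%N by case: y; rewrite // addnC.
rewrite !big_cons big_nil (sumb c b) (sumb c' b').
rewrite !(split_edgeE _ c b) !(split_edgeE _ c' b') /= !permE /=.
rewrite !opt_eq !eqxx ?neqb ?neqb' ?cc ?cc' /=.
by move: (h None) (h (Some (c, b))) (h (Some (c, ~~ b)))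
  (h (Some (c', b'))) (h (Some (c', ~~ b'))) => [] [] [] [] [].
Qed.

(** If the unmatched point is off, the six points carry weight 3 and an odd number of the three
    matchings is crossed; if it is on, they carry weight 2 and no matching is crossed. This is why
    [phi] is negation. *)
Lemma local_relation_free c b c' b' c'' b'' : c != c' -> c' != c'' -> c != c'' ->
  local_relation (Some (c, b)) (Some (c', b')) (Some (c'', b'')).
Proof.
move=> n1 n2 n3; right; exists [:: c; c'; c''], negb; split=> //=.
  by rewrite !inE negb_or n1 n2 n3.
have e1 := negPf n1; have e2 := negPf n2; have e3 := negPf n3.
have e1' : (c' == c) = false by rewrite eq_sym.
have e2' : (c'' == c') = false by rewrite eq_sym.
have e3' : (c'' == c) = false by rewrite eq_sym.
move=> h wt_h; rewrite /triple_sum.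
have out (d : 'I_m) x : d \notin [:: c; c'; c''] ->
    [&& Some (c, b) != Some (d, x) :> label m, Some (c', b') != Some (d, x) :> label m
      & Some (c'', b'') != Some (d, x) :> label m].
  rewrite !inE !negb_or => /and3P[/negPf d1 /negPf d2 /negPf d3].
  by rewrite !opt_eq ![_ == d]eq_sym d1 d2 d3.
rewrite !(split_offE [:: c; c'; c'']) !split_off_tperm; first last.
- by move=> d x /(out _ x)/and3P[o1 o2 o3]; rewrite ?o1 ?o2 ?o3.
- by move=> d x /(out _ x)/and3P[o1 o2 o3]; rewrite ?o1 ?o2 ?o3.
- by move=> d x /(out _ x)/and3P[o1 o2 o3]; rewrite ?o1 ?o2 ?o3.
case: (boolP (split_off _ _)) => [hs|_]; last by [].
have := split_off_wt _ hs wt_h; rewrite /= !inE negb_or n1 n2 n3 => /(_ isT).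
have sumb (x : 'I_m) y : (h (Some (x, false)) + h (Some (x, true)) =
    h (Some (x, y)) + h (Some (x, ~~ y)))%N by case: y; rewrite // addnC.
rewrite !big_cons big_nil (sumb c b) (sumb c' b') (sumb c'' b'').
rewrite !(split_edgeE _ c b) !(split_edgeE _ c' b') !(split_edgeE _ c'' b'') /= !permE /=.
rewrite !opt_eq !eqxx ?neqb ?neqb' ?e1 ?e2 ?e3 ?e1' ?e2' ?e3' /=.
by move: (h None) (h (Some (c, b))) (h (Some (c, ~~ b)))
  (h (Some (c', b'))) (h (Some (c', ~~ b')))
  (h (Some (c'', b''))) (h (Some (c'', ~~ b''))) => [] [] [] [] [] [] [].
Qed.

Lemma local_relationP k1 k2 k3 : k1 != k2 -> k2 != k3 -> k1 != k3 ->
  local_relation k1 k2 k3.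
Proof.
have two (c c' : 'I_m) b b' k : Some (c, b) != Some (c', b') :> label m ->
    k != Some (c, b) -> k != Some (c', b') -> c = c' ->
    local_relation (Some (c, b)) (Some (c', b')) k.
  move=> ne k1n k2n E; subst c'; move: ne k2n; rewrite opt_eq eqxx /= => bb.
  have -> : b' = ~~ b by case: b b' bb {k1n} => [] [].
  exact: local_relation_edge.
have none (c c' : 'I_m) b b' : Some (c, b) != Some (c', b') :> label m ->
    local_relation (Some (c, b)) (Some (c', b')) None.
  by move=> ne; have [/two|/local_relation_none] := eqVneq c c'; apply.
case: k1 k2 k3 => [[c1 b1]|] [[c2 b2]|] [[c3 b3]|] // n1 n2 n3.
- have [e1|d1] := eqVneq c1 c2; first by apply: two => //; rewrite eq_sym.
  have [e2|d2] := eqVneq c2 c3.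
    by do 2!apply: local_relation_rot; apply: two => //; rewrite eq_sym.
  have [e3|d3] := eqVneq c1 c3; last exact: local_relation_free.
  by apply: local_relation_rot; apply: two; rewrite // eq_sym.
- exact: none.
- by apply: local_relation_rot; apply: none; rewrite eq_sym.
- by do 2!apply: local_relation_rot; apply: none.
Qed.

End LocalRelation.

(** * The inner product and the half weight *)

Section QuadraticWeight.

Variable d : nat.
Implicit Types x y : 'rV['F_2]_d.

Definition dot x y : 'F_2 := (x *m y^T) 0 0.

Definition weight x : nat := (\sum_j (x 0%R j != 0%R))%N.

(* On vectors of even weight this is a quadratic form with polarization dot. *)
Definition half_weight x : 'F_2 := (weight x)./2%:R.

Lemma natr_F2 k : k%:R = (odd k)%:R :> 'F_2.
Proof.
elim: k => // k IH; rewrite -natr1 IH /=.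
by case: (odd k); apply: val_inj.
Qed.

Lemma natr_F2_eq0 k : (k%:R == 0 :> 'F_2) = ~~ odd k.
Proof. by rewrite natr_F2; case: (odd k). Qed.

Lemma dotE x y : dot x y = \sum_j x 0 j * y 0 j.
Proof. by rewrite /dot mxE; apply: eq_bigr => j _; rewrite mxE. Qed.

Lemma dotC x y : dot x y = dot y x.
Proof. by rewrite !dotE; apply: eq_bigr => j _; rewrite mulrC. Qed.

Lemma dotDr x y z : dot x (y + z) = dot x y + dot x z.
Proof. by rewrite /dot raddfD /= mulmxDr mxE. Qed.

Lemma dotDl x y z : dot (y + z) x = dot y x + dot z x.
Proof. by rewrite /dot mulmxDl mxE. Qed.

Lemma dotZr x a y : dot x (a *: y) = a * dot x y.
Proof. by rewrite /dot linearZ /= -scalemxAr mxE. Qed.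

Lemma dotZl x a y : dot (a *: y) x = a * dot y x.
Proof. by rewrite /dot -scalemxAl mxE. Qed.

Lemma dot0l x : dot 0 x = 0.
Proof. by rewrite /dot mul0mx mxE. Qed.

Lemma dot0r x : dot x 0 = 0.
Proof. by rewrite dotC dot0l. Qed.

Lemma dotxx x : dot x x = (weight x)%:R.
Proof.
rewrite dotE natr_sum; apply: eq_bigr => j _.
by case: (F2_cases (x 0 j)) => ->; rewrite ?mul0r ?mul1r.
Qed.

Lemma weightD x y : exists2 k, dot x y = k%:R &
  (weight (x + y) + 2 * k = weight x + weight y)%N.
Proof.
exists (\sum_j ((x 0%R j != 0%R) && (y 0%R j != 0%R)))%N.
  rewrite dotE natr_sum; apply: eq_bigr => j _.
  by case: (F2_cases (x 0 j)) => ->; case: (F2_cases (y 0 j)) => ->;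
    rewrite ?mul0r ?mul1r.
rewrite /weight big_distrr -!big_split; apply: eq_bigr => j _ /=; rewrite mxE.
by case: (F2_cases (x 0 j)) => ->; case: (F2_cases (y 0 j)) => ->.
Qed.

Lemma half_weightD x y : dot x x = 0 -> dot y y = 0 ->
  half_weight (x + y) = half_weight x + half_weight y + dot x y.
Proof.
have [k kE wE] := weightD x y; rewrite !dotxx.
move/eqP; rewrite natr_F2_eq0 => /negPf ox /eqP; rewrite natr_F2_eq0 => /negPf oy.
rewrite mul2n in wE; have := congr1 half wE; rewrite !halfD ox oy odd_double doubleK andbF !add0n.
rewrite kE /half_weight -natrD => <-; rewrite natrD -addrA addF2 addr0 //.
Qed.

Lemma half_weightZ a x : half_weight (a *: x) = a ^+ 2 * half_weight x.
Proof.
case: (F2_cases a) => ->; last by rewrite scale1r expr1n mul1r.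
rewrite scale0r expr0n mul0r /half_weight /weight big1 // => j _.
by rewrite mxE.
Qed.

Lemma half_weight0 : half_weight (0 : 'rV['F_2]_d) = 0.
Proof. by rewrite -(scale0r 0) half_weightZ expr0n mul0r. Qed.

(** Pairwise orthogonal singular vectors span a totally singular space; orthogonality also covers i
    = j, so partial sums stay of even weight. *)
Lemma half_weight_sum (I : Type) (r : seq I) (P : pred I) (x : I -> 'rV['F_2]_d) :
    (forall i j, P i -> P j -> dot (x i) (x j) = 0) ->
    (forall i, P i -> half_weight (x i) = 0) ->
  half_weight (\sum_(i <- r | P i) x i) = 0.
Proof.
move=> x_orth x0.
suffices [] : half_weight (\sum_(i <- r | P i) x i) = 0 /\
    dot (\sum_(i <- r | P i) x i) (\sum_(i <- r | P i) x i) = 0 by [].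
elim: r => [|i r [IH1 IH2]].
  by rewrite big_nil dot0l half_weight0.
rewrite big_cons; case Pi: (P i) => //.
have orth : dot (x i) (\sum_(j <- r | P j) x j) = 0.
  apply: (big_ind (fun y => dot (x i) y = 0)) => [|y z yi zi|j Pj]; first exact: dot0r.
    by rewrite dotDr yi zi addr0.
  exact: x_orth.
rewrite half_weightD ?x_orth // x0 // IH1 orth dotDl !dotDr x_orth // IH2 orth.
by rewrite dotC orth !addr0.
Qed.

End QuadraticWeight.

(** * Inner products and weights of polytabloids *)

Section SpechtForm.

Variable m : nat.
Local Notation n := (2 * m).+1.
Local Notation la := [:: m.+1; m].
Local Notation lab := (label m -> 'I_n).
Local Notation bits := {ffun 'I_n -> bool}.
Local Notation al l c := (l (Some (c, false))).
Local Notation be l c := (l (Some (c, true))).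
Local Notation M := #|{: tabloid n la}|.

(** A crossing set contains m points besides possibly the unmatched one, so having size m means
    avoiding the latter. *)
Lemma sum_pt (l : lab) (F : bits -> 'F_2) : injective l ->
  \sum_j pt l 0 j * F (conf (enum_val j)) =
  \sum_(f | crossing l f && ~~ f (l None)) F f.
Proof.
move=> lI; under eq_bigr do rewrite mxE.
rewrite (big_conf (fun f => (crossing l f)%:R * F f)).
rewrite big_mkcond [RHS]big_mkcond; apply: eq_bigr => f _.
case: (boolP (crossing l f)) => [lf|_]; last by rewrite mul0r if_same.
rewrite (crossing_wt lI lf) mul1r -[X in (_ == X)]add0n eqn_add2r.
by case: (f _).
Qed.

Definition flip (z f : bits) : bits := [ffun i => f i (+) z i].

Lemma flipK z : involutive (flip z).
Proof. by move=> f; apply/ffunP=> i; rewrite !ffunE addbK. Qed.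

Definition constant_on_edges (l : lab) (z : bits) : Prop :=
  (forall c, z (al l c) = z (be l c)) /\ z (l None) = false.

Lemma flip_crossing l z f : constant_on_edges l z ->
  crossing l (flip z f) = crossing l f.
Proof.
case=> zE _; apply: eq_forallb => c; rewrite !ffunE zE.
by case: (f _) (f _) (z _) => [] [] [].
Qed.

Lemma sum_flip (l : lab) (F : bits -> 'F_2) z i :
    constant_on_edges l z -> z i ->
    (forall f, crossing l f -> ~~ f (l None) -> F (flip z f) = F f) ->
  \sum_(f | crossing l f && ~~ f (l None)) F f = 0.
Proof.
move=> zl zi FE; apply: (@sum_involution _ _ _ (flip z)).
- exact: flipK.
- move=> f _; apply: contraTneq zi => /ffunP/(_ i); rewrite ffunE.
  by case: (f i) (z i) => [] [].
- by move=> f; rewrite flip_crossing // ffunE (proj2 zl) addbF.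
- by move=> f /andP[]; apply: FE.
Qed.

Lemma dot_ptE (l l' : lab) : injective l -> dot (pt l) (pt l') =
  \sum_(f | crossing l f && ~~ f (l None)) (crossing l' f)%:R.
Proof. by move=> lI; rewrite -sum_pt // dotE; apply: eq_bigr => j _; rewrite !mxE. Qed.

Lemma dot_pt_flip (l l' : lab) z i : injective l ->
    constant_on_edges l z -> (forall c, z (al l' c) = z (be l' c)) -> z i ->
  dot (pt l) (pt l') = 0.
Proof.
move=> lI zl zl' zi; rewrite dot_ptE //; apply: sum_flip zl zi _ => f _ _.
congr (nat_of_bool _)%:R; apply: eq_forallb => c; rewrite !ffunE zl'.
by case: (f _) (f _) (z _) => [] [] [].
Qed.

(** Complementing a set away from the common unmatched point pairs off the common crossing sets. *)
Lemma dot_pt_unmatched (l l' : lab) : (0 < m)%N -> injective l -> injective l' ->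
  l None = l' None -> dot (pt l) (pt l') = 0.
Proof.
move=> m0 lI lI' E; pose z : bits := [ffun i => i != l None].
apply: (dot_pt_flip (z := z) (i := al l (Ordinal m0))) => //.
- by split=> [c|]; rewrite !ffunE ?eqxx // !(inj_eq lI).
- by move=> c; rewrite !ffunE E !(inj_eq lI').
- by rewrite ffunE (inj_eq lI).
Qed.

(** Flipping both ends of the shared edge pairs off the common crossing sets. *)
Lemma dot_pt_edge (l l' : lab) c : injective l -> injective l' ->
  al l c = al l' c -> be l c = be l' c -> dot (pt l) (pt l') = 0.
Proof.
move=> lI lI' Ea Eb; pose z : bits := [ffun i => (i == al l c) || (i == be l c)].
apply: (dot_pt_flip (z := z) (i := al l c)) => //.
- split=> [b|]; rewrite !ffunE !(inj_eq lI) // !(inj_eq Some_inj) !xpair_eqE.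
  by rewrite !andbT !andbF orbF.
- move=> b; rewrite !ffunE Ea Eb !(inj_eq lI') !(inj_eq Some_inj) !xpair_eqE.
  by rewrite !andbT !andbF orbF.
- by rewrite ffunE eqxx.
Qed.

(* The only place where m = 2 has to be excluded. *)
Lemma edge_avoiding (k1 k2 k3 : label m) : (3 <= m)%N ->
    None \in [:: k1; k2; k3] ->
  exists c, forall b, Some (c, b) \notin [:: k1; k2; k3].
Proof.
move=> m3 Nk; pose col (k : label m) := omap fst k.
have : (size (pmap col [:: k1; k2; k3]) < m)%N.
  apply: leq_trans m3; rewrite size_pmap /=.
  by move: Nk; rewrite !inE; case: k1 k2 k3 => [?|] [?|] [?|].
case: (pickP [pred c | c \notin pmap col [:: k1; k2; k3]]) => [c cs _|H].
  exists c => b; apply: contra cs => /(map_f col).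
  by rewrite mem_pmap.
rewrite ltnNge -[X in (X <= _)%N]card_ord cardE uniq_leq_size ?enum_uniq //.
by move=> c _; apply: negbFE; apply: H.
Qed.

Lemma tperm_label (l : lab) k1 k2 : injective l ->
  tperm (l k1) (l k2) \o l =1 l \o tperm k1 k2.
Proof. by move=> lI k; rewrite /= inj_tperm. Qed.

Lemma perm_label_inj (l : lab) (g : 'S_n) : injective l -> injective (g \o l).
Proof. by apply: inj_comp; apply: perm_inj. Qed.

(** Either the unmatched point is not moved and remains common, or it is one of i, j, k; then at
    most two edges are touched and, as m is at least 3, some edge remains common. *)
Lemma dot_pt_move (l : lab) (i j k : 'I_n) (g h : 'S_n) : (3 <= m)%N -> injective l ->
    (forall x, x \notin [:: i; j; k] -> g x = x) ->
    (forall x, x \notin [:: i; j; k] -> h x = x) ->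
  dot (pt (g \o l)) (pt (h \o l)) = 0.
Proof.
move=> m3 lI gx hx; have m0 : (0 < m)%N by apply: leq_trans m3.
have [lN|lN] := boolP (l None \in [:: i; j; k]); last first.
  by apply: dot_pt_unmatched; rewrite /= ?gx ?hx //; apply: perm_label_inj.
have [k1 E1] := label_surj lI i; have [k2 E2] := label_surj lI j.
have [k3 E3] := label_surj lI k.
have [c cN] : exists c, forall b, Some (c, b) \notin [:: k1; k2; k3].
  apply: edge_avoiding => //.
  by rewrite E1 E2 E3 in lN; rewrite -(mem_map lI).
have lc b : l (Some (c, b)) \notin [:: i; j; k].
  by rewrite E1 E2 E3; have := cN b; rewrite -(mem_map lI).
by apply: (@dot_pt_edge _ _ c); rewrite /= ?gx ?hx //; apply: perm_label_inj.
Qed.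

Definition star_relation (i j k : 'I_n) : 'M['F_2]_M :=
  tabloid_mx 'F_2 la (tperm i j) + tabloid_mx 'F_2 la (tperm j k) +
  tabloid_mx 'F_2 la (tperm i k).

(* Pigeonhole: fewer conditions than points. *)
Lemma common_kernel (l l' : lab) (s : seq 'I_m) : uniq s -> (2 <= size s)%N ->
  exists z : bits, exists i : 'I_n, [/\ z i, constant_on_edges l' z, z (l None) = false &
    forall c, c \notin s -> z (al l c) = z (be l c)].
Proof.
move=> us s2.
pose I : finType := (option 'I_m + option {c : 'I_m | c \notin s})%type.
pose ev (f : bits) : {ffun I -> bool} := [ffun k : I => match k with
  | inl (Some c) => f (al l' c) (+) f (be l' c) | inl None => f (l' None)
  | inr (Some c) => f (al l (val c)) (+) f (be l (val c)) | inr None => f (l None)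
  end].
(* There are m+1 conditions from [l'] and 1 + (m - |s|) from [l], at most 2m in all since |s| is at
   least 2. *)
have cI : (#|I| < n)%N.
  rewrite card_sum !card_option card_ord card_sig.
  have : (#|[predC s]| + 2 <= m)%N.
    by rewrite -[X in (_ <= X)%N](card_ord m) -(cardC (mem s)) (card_uniqP us) addnC leq_add2r.
  have -> : #|[pred c | c \notin s]| = #|[predC s]| by apply: eq_card.
  rewrite addn2 ltnS => h; rewrite mul2n -addnn addSn -addnS leq_add2l.
  exact: h.
have /injectivePn[f [f' ff' E]] : ~~ injectiveb ev.
  apply/negP=> /injectiveP/leq_card.
  by rewrite !card_ffun card_bool card_ord leq_exp2l // leqNgt cI.
have [i fi] : exists i, f i != f' i.
  apply/existsP; rewrite -negb_forall; apply: contra ff' => /forallP H.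
  by apply/eqP/ffunP=> i; apply/eqP/H.
have EE k : ev f k = ev f' k by rewrite E.
exists (flip f' f), i; rewrite !ffunE; split.
- by case: (f i) (f' i) fi => [] [].
- split=> [c|]; first by have := EE (inl (Some c)); rewrite !ffunE;
    move: (f (al l' c)) (f (be l' c)) (f' (al l' c)) (f' (be l' c)) => [] [] [] [].
  by have := EE (inl None); rewrite !ffunE => ->; rewrite addbb.
- by have := EE (inr None); rewrite !ffunE => ->; rewrite addbb.
- move=> c cs; have := EE (inr (Some (Sub c cs))); rewrite !ffunE /=.
  by move: (f (al l c)) (f (be l c)) (f' (al l c)) (f' (be l c)) => [] [] [] [].
Qed.

Lemma config_wt_crossing (l l' : lab) f : injective l -> injective l' ->
  crossing l' f -> ~~ f (l' None) -> config_wt (f \o l) = m.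
Proof.
move=> lI lI' lf /negPf fN; have := crossing_wt lI' lf; rewrite fN add0n => E.
by rewrite -[RHS]E /wt (big_label lI addn (fun i => f i : nat)).
Qed.

(** The flip [z] preserves the crossing sets of [l'] and, by the local form of the coefficients, the
    summand as well; so the sum vanishes by pairing. *)
Lemma star_relation_perp (l l' : lab) i j k : injective l -> injective l' ->
    i != j -> j != k -> i != k ->
  dot (pt l') (pt l *m star_relation i j k) = 0.
Proof.
move=> lI lI' ij jk ik.
have [k1 E1] := label_surj lI i; have [k2 E2] := label_surj lI j.
have [k3 E3] := label_surj lI k; rewrite {i}E1 {j}E2 {k}E3 !(inj_eq lI) in ij jk ik *.
pose F (f : bits) : 'F_2 := (triple_sum k1 k2 k3 (f \o l))%:R.
rewrite /star_relation !mulmxDr !pt_act !(eq_pt (tperm_label _ _ lI)).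
have -> : dot (pt l') (pt (l \o tperm k1 k2) + pt (l \o tperm k2 k3) + pt (l \o tperm k1 k3))
    = \sum_(f | crossing l' f && ~~ f (l' None)) F f.
  rewrite -sum_pt // dotE; apply: eq_bigr => x _; congr (_ * _); rewrite !mxE.
  rewrite /F /triple_sum natr_F2 -!natrD natr_F2 !oddD !oddb /crossing.
  by congr (nat_of_bool _)%:R; rewrite oddb.
have [T0|[s [phi [us s2 T]]]] := local_relationP ij jk ik.
  by rewrite big1 // => f _; rewrite /F (negPf (T0 _)).
have [z [i [zi zl' zN zl]]] := common_kernel l l' us s2.
apply: (sum_flip zl' zi) => f fl' fN; rewrite /F !T.
- congr (nat_of_bool (_ && _))%:R; last by rewrite /= ffunE zN addbF.
  apply: eq_forallb => c; case: (boolP (c \in s)) => //= cs.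
  rewrite /split_edge /= !ffunE zl //.
  by move: (f (al l c)) (f (be l c)) (z (be l c)) => [] [] [].
- exact: config_wt_crossing fl' fN.
- apply: (config_wt_crossing lI lI'); first by rewrite flip_crossing.
  by rewrite ffunE (proj2 zl') addbF.
Qed.

Lemma card_crossing (l : lab) : injective l ->
  #|[set f | crossing l f && ~~ f (l None)]| = (2 ^ m)%N.
Proof.
move=> lI; have [g lK Kl] := label_bij lI.
pose G (a : {ffun 'I_m -> bool}) : bits :=
  [ffun x => if g x is Some (c, b) then a c (+) b else false].
have GE a c b : G a (l (Some (c, b))) = a c (+) b by rewrite ffunE lK.
have GN a : G a (l None) = false by rewrite ffunE lK.
have GI : injective G.
  by move=> a a' E; apply/ffunP=> c; rewrite -[LHS]addbF -[RHS]addbF -!GE E.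
rewrite -[RHS](_ : #|[set G a | a in [set: {ffun 'I_m -> bool}]]| = _); last first.
  by rewrite card_imset // cardsT card_ffun card_bool card_ord.
apply: eq_card => f; rewrite inE; apply/andP/imsetP=> [[/forallP fl fN]|[a _ ->]].
  exists [ffun c => f (al l c)] => //; apply/ffunP=> x.
  have [[[c b]|] ->] := label_surj lI x; last by rewrite GN (negPf fN).
  rewrite GE ffunE; have := fl c; case: b; rewrite ?addbF //.
  by move: (f (al l c)) (f (be l c)) => [] [].
by rewrite GN; split=> //; apply/forallP=> c; rewrite !GE addbF addbT; case: (a c).
Qed.

Lemma weight_pt (l : lab) : injective l -> weight (pt l) = (2 ^ m)%N.
Proof.
move=> lI; rewrite -(card_crossing lI) /weight -sum1dep_card.
under eq_bigr do rewrite mxE.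
rewrite (big_conf (fun f => (crossing l f)%:R != 0 :> 'F_2 : nat)).
rewrite big_mkcond [RHS]big_mkcond; apply: eq_bigr => f _.
case: (boolP (crossing l f)) => [lf|_]; last by rewrite if_same.
by rewrite (crossing_wt lI lf) -[X in (_ == X)]add0n eqn_add2r; case: (f _).
Qed.

Lemma half_weight_pt (l : lab) : (2 <= m)%N -> injective l -> half_weight (pt l) = 0.
Proof.
move=> m2 lI; rewrite /half_weight weight_pt //; apply/eqP; rewrite natr_F2_eq0.
case: (m) m2 => [|[|k]] // _.
by rewrite !expnS !mul2n doubleK odd_double.
Qed.

Lemma dot_ptxx (l : lab) : (1 <= m)%N -> injective l -> dot (pt l) (pt l) = 0.
Proof.
move=> m1 lI; rewrite dotxx weight_pt //; apply/eqP; rewrite natr_F2_eq0 oddX.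
by rewrite orbF -lt0n m1.
Qed.

(** The three summands are polytabloids, hence singular, and [dot_pt_move] makes them pairwise
    orthogonal. *)
Lemma star_relation_half_weight (l : lab) i j k : (3 <= m)%N -> injective l ->
    i != j -> j != k -> i != k ->
  half_weight (pt l *m star_relation i j k) = 0.
Proof.
move=> m3 lI ij jk ik; have m1 : (1 <= m)%N by apply: leq_trans m3.
have m2 : (2 <= m)%N by apply: leq_trans m3.
rewrite /star_relation !mulmxDr !pt_act.
have tx a b x : a \in [:: i; j; k] -> b \in [:: i; j; k] ->
    x \notin [:: i; j; k] -> tperm a b x = x.
  move=> ak bk xk; apply: tpermD; apply: contraNneq xk => <- //.
have orth a b c d : [&& a \in [:: i; j; k], b \in [:: i; j; k],
    c \in [:: i; j; k] & d \in [:: i; j; k]] ->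
    dot (pt (tperm a b \o l)) (pt (tperm c d \o l)) = 0.
  case/and4P=> ak bk ck dk.
  by apply: (@dot_pt_move _ i j k) => // x; apply: tx.
have pI a b : injective (tperm a b \o l) by apply: perm_label_inj.
have ins : (i \in [:: i; j; k]) * (j \in [:: i; j; k]) * (k \in [:: i; j; k]).
  by rewrite !inE !eqxx !orbT.
rewrite half_weightD ?dotDl ?dotDr ?orth ?ins // ?addr0 //.
rewrite half_weightD ?orth ?ins // ?addr0 //.
by rewrite !half_weight_pt // !addr0.
Qed.

Lemma half_weight_tabloid x (g : 'S_n) : half_weight (x *m tabloid_mx 'F_2 la g) = half_weight x.
Proof.
congr (_./2%:R); rewrite mul_tabloid_mx /weight.
pose phi (j : 'I_M) := enum_rank (tabloid_act (enum_val j) g^-1%g).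
have phiI : injective phi.
  move=> j j' /enum_rank_inj/(congr1 val)/row_act_inj/val_inj.
  exact: enum_val_inj.
by rewrite [RHS](reindex_inj phiI); apply: eq_bigr => j _; rewrite !mxE.
Qed.

(* The two matchings form a Hamiltonian path, so there is exactly one common  *)
(* crossing set of size m.                                                    *)
Lemma dot_pt_path (l : lab) : (0 < m)%N -> injective l ->
  exists2 l' : lab, injective l' & dot (pt l) (pt l') = 1.
Proof.
move=> m0 lI.
(* The new edges join the second end of each edge to the first end of the next one, and the last
   second end to the old unmatched point; the first end of edge 0 becomes unmatched. *)
pose nxt (c : 'I_m) : label m :=
  if insub c.+1 is Some c' then Some (c' : 'I_m, false) else None.
pose sg (k : label m) : label m := match k with
  | None => Some (Ordinal m0, false) | Some (c, false) => Some (c, true)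
  | Some (c, true) => nxt c end.
have nxtP (c : 'I_m) : (exists2 c' : 'I_m, c' = c.+1 :> nat & nxt c = Some (c', false))
           \/ c.+1 = m /\ nxt c = None.
  rewrite /nxt; case: insubP => [c' _ E|]; first by left; exists c'.
  by rewrite -leqNgt => mc; right; split=> //; apply/eqP; rewrite eqn_leq mc ltn_ord.
have sgI : injective sg.
  have e0 c c' : nxt c = nxt c' -> c = c'.
    case: (nxtP c) => [[d dE ->]|[cm ->]]; case: (nxtP c') => [[d' dE' ->]|[cm' ->]] //.
      by case=> E; apply: val_inj; apply: succn_inj; rewrite /= -dE -dE' E.
    by move=> _; apply: val_inj; apply: succn_inj; rewrite /= cm cm'.
  have e1 c c' : nxt c = Some (c', true) -> False.
    by case: (nxtP c) => [[d _ ->]|[_ ->]].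
  have e2 c : nxt c = Some (Ordinal m0, false) -> False.
    by case: (nxtP c) => [[d dE ->] [E]|[_ ->]] //; rewrite E in dE.
  move=> [[c []]|] [[c' []]|] //=.
  - by move/e0->.
  - by move/e1.
  - by move/e2.
  - by move/esym/e1.
  - by case=> ->.
  - by move/esym/e2.
exists (l \o sg); first exact: inj_comp.
have [g lK Kl] := label_bij lI.
pose f0 : bits := [ffun x => if g x is Some (c, b) then b else false].
have f0E c b : f0 (l (Some (c, b))) = b by rewrite ffunE lK.
have f0N : f0 (l None) = false by rewrite ffunE lK.
rewrite dot_ptE // (bigD1 f0) /=; last first.
  by rewrite f0N andbT; apply/forallP=> c; rewrite !f0E.
rewrite big1 ?addr0 => [|f /andP[/andP[/forallP fl fN] ff0]].
  rewrite [crossing _ _](_ : _ = true) //; apply/forallP=> c /=; rewrite f0E.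
  by case: (nxtP c) => [[d _ ->]|[_ ->]]; rewrite ?f0E ?f0N.
case: (boolP (crossing _ f)) => // /forallP fl'; case/eqP: ff0.
(* Walk back along the path: the old unmatched point is off, so the second end of the last edge is
   on, its first end is off, and so on. This forces [f] to be [f0]. *)
have fbe i (c : 'I_m) : (m - c <= i)%N -> f (be l c).
  elim: i c => [|i IH] c; first by rewrite leqn0 subn_eq0 leqNgt ltn_ord.
  move=> ci; have := fl' c => /=; case: (nxtP c) => [[d dE ->]|[_ ->]]; last first.
    by rewrite (negPf fN); case: (f _).
  have fd : f (be l d).
    by apply: IH; rewrite dE subnS -ltnS prednK // subn_gt0.
  by have := fl d; rewrite fd; move: (f (al l d)) (f (be l c)) => [] [].
apply/ffunP=> x; have [[[c b]|] ->] := label_surj lI x; last first.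
  by rewrite f0N (negPf fN).
rewrite f0E; have := fl c; rewrite (fbe _ c (leqnn _)).
by case: b; [rewrite (fbe _ c (leqnn _)) | case: (f _)].
Qed.

End SpechtForm.

(** * The spin module *)

Section SpinQuotient.

Variable m : nat.
Hypothesis m3 : (3 <= m)%N.
Local Notation n := (2 * m).+1.
Local Notation la := [:: m.+1; m].
Local Notation lab := (label m -> 'I_n).
Local Notation T := (tabloid_repr 'F_2 n la).
Local Notation tS := (specht 'F_2 n la).
Local Notation tR := (tS :&: specht_perp 'F_2 n la)%MS.
Local Notation M := #|{: tabloid n la}|.
Local Notation modS := (specht_module 'F_2 n la).

Let m0 : (0 < m)%N. Proof. exact: leq_trans m3. Qed.

Lemma specht_ind (P : 'rV['F_2]_M -> Prop) :
    P 0 -> (forall x y, (x <= tS)%MS -> (y <= tS)%MS -> P x -> P y -> P (x + y)) ->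
    (forall l : lab, injective l -> P (pt l)) ->
  forall x, (x <= tS)%MS -> P x.
Proof.
move=> P0 PD Ppt x /sub_sumsmxP[u ->].
pose PS y := (y <= tS)%MS /\ P y.
suffices [] : PS (\sum_(t | is_tableau t) u t *m <<polytabloid 'F_2 t>>%MS) by [].
apply: (big_ind PS) => [|y z [yS Py] [zS Pz]|t /tableau_label[l lI ->]].
- by split; rewrite ?sub0mx.
- by rewrite /PS addmx_sub //; split=> //; apply: PD.
have : (u t *m <<pt l>>%MS <= pt l)%MS by rewrite mulmx_sub ?genmxE.
case/sub_rVP=> a ->; case: (F2_cases a) => ->.
  by rewrite scale0r; split; rewrite ?sub0mx.
by rewrite /PS scale1r pt_specht //; split=> //; apply: Ppt.
Qed.

Lemma dot_specht x : (x <= tS)%MS -> dot x x = 0.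
Proof.
move: x; apply: specht_ind => [|x y _ _ xx yy|l lI]; last exact: dot_ptxx.
  exact: dot0l.
by rewrite dotDl !dotDr xx yy add0r addr0 (dotC y) addF2.
Qed.

Lemma perpP x : reflect (forall y, (y <= tS)%MS -> dot x y = 0)
                        (x <= specht_perp 'F_2 n la)%MS.
Proof.
rewrite /specht_perp; apply: (iffP sub_kermxP) => [xS y /submxP[u ->]|H].
  by rewrite /dot trmx_mul mulmxA xS mul0mx mxE.
apply/rowP=> j; rewrite [RHS]mxE -(H _ (row_sub j tS)) dotE mxE.
by apply: eq_bigr => k _; rewrite !mxE.
Qed.

Lemma pt_perp x : (forall l : lab, injective l -> dot (pt l) x = 0) ->
  (x <= specht_perp 'F_2 n la)%MS.
Proof.
move=> H; apply/perpP; apply: specht_ind => [|y z _ _ xy xz|l lI].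
- exact: dot0r.
- by rewrite dotDr xy xz addr0.
- by rewrite dotC H.
Qed.

Lemma pt_notin_radical (l : lab) : injective l -> ~~ (pt l <= tR)%MS.
Proof.
move=> lI; have [l' lI' E] := dot_pt_path m0 lI.
rewrite sub_capmx; apply/negP=> /andP[_ /perpP/(_ _ (pt_specht lI'))].
by rewrite E.
Qed.

Lemma star_relation_conj i j k (g : 'S_n) :
  star_relation i j k *m tabloid_mx 'F_2 la g =
  tabloid_mx 'F_2 la g *m star_relation (g i) (g j) (g k).
Proof.
have E a b : tabloid_mx 'F_2 la (tperm a b) *m tabloid_mx 'F_2 la g =
    tabloid_mx 'F_2 la g *m tabloid_mx 'F_2 la (tperm (g a) (g b)).
  have TM x y : tabloid_mx 'F_2 la (x * y)%g = T x *m T y by rewrite -repr_mxM ?in_setT.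
  by rewrite -[LHS]TM -[RHS]TM conjgC tpermJ.
have D (G X Y Z X' Y' Z' : 'M['F_2]_M) :
    X *m G = G *m X' -> Y *m G = G *m Y' -> Z *m G = G *m Z' ->
    (X + Y + Z) *m G = G *m (X' + Y' + Z').
  by move=> e1 e2 e3; rewrite !mulmxDl !mulmxDr e1 e2 e3.
by apply: D; apply: E.
Qed.

(** Generators of the radical on which the half weight can be computed. *)
Definition star_submodule : 'M['F_2]_M :=
  (\sum_(a : {ffun label m -> 'I_n} * ('I_n * 'I_n * 'I_n) |
      injectiveb a.1 && [&& a.2.1.1 != a.2.1.2, a.2.1.2 != a.2.2 & a.2.1.1 != a.2.2])
     <<pt a.1 *m star_relation a.2.1.1 a.2.1.2 a.2.2>>)%MS.
Local Notation tI := star_submodule.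

Lemma star_submodule_module : mxmodule T tI.
Proof.
apply/mxmoduleP=> g _; rewrite sumsmxMr; apply/sumsmx_subP=> -[l [[i j] k]] /=.
case/andP=> /injectiveP lI /and3P[ij jk ik]; rewrite (eqmxMr _ (genmxE _)).
rewrite -mulmxA star_relation_conj mulmxA pt_act.
rewrite (sumsmx_sup ([ffun x => g (l x)], ((g i, g j), g k))) //=.
  rewrite !(inj_eq perm_inj) ij jk ik !andbT; apply/injectiveP=> x y.
  by rewrite !ffunE => /perm_inj/lI.
rewrite genmxE (eq_pt (_ : g \o l =1 [ffun x => g (l x)])) // => x.
by rewrite ffunE.
Qed.

Lemma star_in_submodule (x : 'rV['F_2]_M) i j k : i != j -> j != k -> i != k -> (x <= tS)%MS ->
  (x *m star_relation i j k <= tI)%MS.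
Proof.
move=> ij jk ik; move: x; apply: specht_ind => [|x y _ _ xI yI|l lI].
- by rewrite mul0mx sub0mx.
- by rewrite mulmxDl addmx_sub.
rewrite (sumsmx_sup (finfun l, ((i, j), k))) //=.
  by rewrite ij jk ik !andbT; apply/injectiveP=> x y; rewrite !ffunE => /lI.
rewrite genmxE (eq_pt (_ : l =1 finfun l)) // => x.
by rewrite ffunE.
Qed.

Lemma star_submodule_radical (x : 'rV['F_2]_M) : (x <= tI)%MS -> (x <= tR)%MS /\ half_weight x = 0.
Proof.
case/sub_sumsmxP=> u ->.
apply: (big_ind (fun x => (x <= tR)%MS /\ half_weight x = 0)).
- by rewrite sub0mx half_weight0.
- move=> {}x y [xR qx] [yR qy]; rewrite addmx_sub //; split=> //.
  have [xS xP] : (x <= tS)%MS /\ (x <= specht_perp 'F_2 n la)%MS.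
    by apply/andP; rewrite -sub_capmx.
  have yS : (y <= tS)%MS by apply: submx_trans yR (capmxSl _ _).
  by rewrite half_weightD ?dot_specht // qx qy (perpP _ xP) // !addr0.
case=> l [[i j] k] /= /andP[/injectiveP lI /and3P[ij jk ik]].
set y := pt l *m _; have : (u (l, (i, j, k)) *m <<y>>%MS <= y)%MS.
  by rewrite mulmx_sub ?genmxE.
case/sub_rVP=> a ->; rewrite half_weightZ star_relation_half_weight // mulr0.
split=> //; rewrite scalemx_sub // sub_capmx; apply/andP; split.
  by rewrite /y !mulmxDr !pt_act !addmx_sub // pt_specht //; apply: perm_label_inj.
by apply: pt_perp => l' lI'; apply: star_relation_perp.
Qed.

Lemma pt_edge (l : lab) c : injective l ->
  pt l *m T (tperm (l (Some (c, false))) (l (Some (c, true)))) = pt l.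
Proof.
move=> lI; rewrite [T _]/= pt_act (eq_pt (tperm_label _ _ lI)).
apply/rowP=> j; rewrite !mxE; congr (nat_of_bool _)%:R; apply: eq_forallb => b /=.
have [->|bc] := eqVneq b c; first by rewrite tpermL tpermR eq_sym.
by rewrite !tpermD // (inj_eq Some_inj) xpair_eqE eq_sym (negPf bc).
Qed.

Section Quotient.

(** The Clifford argument applies to any submodule between I and R; it is used at both ends to
    compare their ranks. *)
Variable A : 'M['F_2]_M.
Hypotheses (modA : mxmodule T A) (sIA : (tI <= A)%MS) (sAR : (A <= tR)%MS).
Local Notation sA := (section_repr modA modS).

Lemma sub_specht : (A <= tS)%MS.
Proof. exact: submx_trans sAR (capmxSl _ _). Qed.

Lemma spin_quotient_tr3 i j k : i != j -> j != k -> i != k ->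
  sA (tperm i j) + sA (tperm j k) + sA (tperm i k) = 0.
Proof.
move=> ij jk ik; apply/row_matrixP=> r; rewrite rowE row0.
set v := delta_mx _ _; set w := of_section (U := A) (V := tS) v.
have wS : (w <= tS)%MS by apply: of_section_sub sub_specht v.
have E g : v *m sA g = to_section A tS (w *m T g).
  by rewrite (to_sectionJ modA modS wS (in_setT g)) [to_section _ _ w]of_sectionK.
have D d d' (x : 'rV['F_2]_d) (X Y Z : 'M['F_2]_(d, d')) :
    x *m (X + Y + Z) = x *m X + x *m Y + x *m Z by rewrite !mulmxDr.
rewrite D; apply: etrans (congr2 +%R (congr2 +%R (E _) (E _)) (E _)) _.
rewrite -!to_sectionD -D.
apply/eqP; rewrite to_section_eq0.
  by apply: submx_trans sIA; apply: star_in_submodule.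
by rewrite D !addmx_sub //; apply: (mxmodule_trans modS) => //; rewrite in_setT.
Qed.

Variable l : lab.
Hypothesis lI : injective l.
Local Notation e := (to_section A tS (pt l)).

Lemma spin_quotient_fix c :
  e *m sA (tperm (l (Some (c, false))) (l (Some (c, true)))) = e.
Proof. by rewrite -(to_sectionJ modA modS (pt_specht lI) (in_setT _)) pt_edge. Qed.

Lemma spin_quotient_gen (U : 'M_(\rank <<in_factmod A tS>>%MS)) :
  mxmodule sA U -> (e <= U)%MS -> (1%:M <= U)%MS.
Proof.
apply: section_gen => //; first exact: sub_specht.
  exact: pt_specht.
exact: specht_gen.
Qed.

Lemma spin_quotient_neq0 : e != 0.
Proof.
rewrite to_section_eq0 ?pt_specht //.
by apply: contra (pt_notin_radical lI) => /submx_trans; apply.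
Qed.

Lemma spin_quotient_rank : (2 ^ m + \rank A)%N = \rank tS.
Proof.
rewrite -(section_rank sub_specht); congr (_ + _)%N; apply/esym.
exact: (spin_dimE spin_quotient_tr3 lI spin_quotient_fix spin_quotient_gen spin_quotient_neq0).
Qed.

End Quotient.

End SpinQuotient.

(** * The quadratic form on the spin module and the socle *)

Section SpinForm.

Variable m : nat.
Hypothesis m3 : (3 <= m)%N.
Local Notation n := (2 * m).+1.
Local Notation la := [:: m.+1; m].
Local Notation lab := (label m -> 'I_n).
Local Notation tS := (specht 'F_2 n la).
Local Notation tR := (tS :&: specht_perp 'F_2 n la)%MS.
Local Notation modS := (specht_module 'F_2 n la).
Local Notation modR := (specht_radical_module 'F_2 n la).
Local Notation V := (spin_repr m).
Local Notation d := (spin_dim m).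

Let m0 : (0 < m)%N. Proof. exact: leq_trans m3. Qed.
Let sRS : (tR <= tS)%MS. Proof. exact: capmxSl. Qed.

Lemma label_exists p : exists2 l : lab, injective l & l None = p.
Proof.
have c : #|{: label m}| = #|'I_n|.
  by rewrite card_option card_prod card_bool !card_ord mulnC.
pose l0 (k : label m) : 'I_n := enum_val (cast_ord c (enum_rank k)).
have l0I : injective l0.
  by move=> k k' /enum_val_inj/cast_ord_inj/enum_rank_inj.
exists (tperm (l0 None) p \o l0); last by rewrite /= tpermL.
exact: perm_label_inj.
Qed.

Lemma submodule_in_radical : (star_submodule m <= tR)%MS.
Proof.
by apply/row_subP=> i; have [] := star_submodule_radical m3 (row_sub i (star_submodule m)).
Qed.

(* The quotients of the Specht module by star_submodule and by the radical    *)
(* have the same dimension 2 ^ m.                                             *)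
Lemma half_weight_radical x : (x <= tR)%MS -> half_weight x = 0.
Proof.
move=> xR; suff /(submx_trans xR)/(star_submodule_radical m3)[] : (tR <= star_submodule m)%MS by [].
have [l lI _] := label_exists ord0.
have E1 := spin_quotient_rank m3 (star_submodule_module m) (submx_refl _) submodule_in_radical lI.
have E2 := spin_quotient_rank m3 modR submodule_in_radical (submx_refl _) lI.
by rewrite -(geq_leqif (mxrank_leqif_sup submodule_in_radical)) -(leq_add2l (2 ^ m)) E1 E2.
Qed.

Local Notation proj := (to_section tR tS).
Local Notation lift := (@of_section _ _ tR tS).

Definition spin_form (v : 'rV['F_2]_d) : 'F_2 := half_weight (lift v).

Definition spin_polar (u v : 'rV['F_2]_d) : 'F_2 := dot (lift u) (lift v).

Lemma spin_polar_bilinear :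
  (forall v, GRing.linear_for *%R (spin_polar^~ v)) *
  (forall u, GRing.linear_for *%R (spin_polar u)).
Proof.
by split=> u a v w; rewrite /spin_polar of_sectionD of_sectionZ
  ?dotDl ?dotDr ?dotZl ?dotZr.
Qed.

HB.instance Definition _ := bilinear_isBilinear.Build 'F_2 'rV['F_2]_d 'rV['F_2]_d 'F_2
  _ _ spin_polar spin_polar_bilinear.

Lemma lift_sub v : (lift v <= tS)%MS.
Proof. exact: of_section_sub sRS v. Qed.

(** The value does not depend on the lift: two lifts differ by an element of the radical, which is
    orthogonal to S and has half weight 0. *)
Lemma spin_form_proj x : (x <= tS)%MS -> spin_form (proj x) = half_weight x.
Proof.
move=> xS; have := to_sectionK sRS xS.
rewrite oppmxF2 => zR.
set z := x + _ in zR; have zP : (z <= specht_perp 'F_2 n la)%MS.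
  exact: submx_trans zR (capmxSr _ _).
have -> : spin_form (proj x) = half_weight (x + z).
  by rewrite /z addrA addmxF2 add0r.
have zS := submx_trans zR sRS.
by rewrite half_weightD ?dot_specht // (half_weight_radical zR) dotC (perpP _ zP) // !addr0.
Qed.

Lemma spin_form_polarization :
  is_polarization spin_form (spin_polar : {biscalar 'rV['F_2]_d}).
Proof.
have orth u : dot (lift u) (lift u) = 0 by apply/(dot_specht m3)/lift_sub.
split=> [u|u v]; first exact: orth.
by rewrite /spin_form of_sectionD half_weightD.
Qed.

Lemma spin_form_quadratic : quadratic_form spin_form.
Proof.
split; last by exists (spin_polar : {biscalar _}); exact: spin_form_polarization.
by move=> a u; rewrite /spin_form of_sectionZ half_weightZ.
Qed.

(** A lift orthogonal to all of S lies in R, hence is 0 in the quotient. *)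
Lemma spin_form_nondegenerate : nondegenerate_form spin_form.
Proof.
exists (spin_polar : {biscalar _}); first exact: spin_form_polarization.
move=> u u0; apply/eqP; rewrite -(of_sectionK u) to_section_eq0 ?lift_sub //.
rewrite sub_capmx lift_sub /=; apply/perpP => y yS.
have := u0 (proj y); rewrite /= /spin_polar.
have := to_sectionK sRS yS; rewrite oppmxF2 sub_capmx => /andP[_ /perpP/(_ _ (lift_sub u))].
by rewrite dotC dotDr => /eqP; rewrite addr_eq0 => /eqP-> ->; rewrite oppr0.
Qed.

Lemma spin_form_invariant : invariant_form V spin_form.
Proof.
move=> g v Gg; rewrite -[v](of_sectionK (U := tR) (V := tS)).
rewrite -(to_sectionJ modR modS (lift_sub v) Gg).
apply: etrans (spin_form_proj (mxmodule_trans modS Gg (lift_sub v))) _.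
rewrite (spin_form_proj (lift_sub v)); exact: half_weight_tabloid.
Qed.

Section Stabilizer.

Variable l : lab.
Hypothesis lI : injective l.
Local Notation p := (l None).
Local Notation H := (point_stabilizer p).
Local Notation e := (proj (pt l) : 'rV['F_2]_d).
Local Notation U := (restriction_socle V (subsetT H)).

Let tr3 i j k : i != j -> j != k -> i != k ->
  V (tperm i j) + V (tperm j k) + V (tperm i k) = 0.
Proof. exact: (spin_quotient_tr3 modR submodule_in_radical (submx_refl _)). Qed.

Let e_fix c : e *m V (tperm (l (Some (c, false))) (l (Some (c, true)))) = e.
Proof. exact: (spin_quotient_fix modR lI). Qed.

Let e_gen (W : 'M_d) : mxmodule V W -> (e <= W)%MS -> (1%:M <= W)%MS.
Proof. move=> mW eW; exact: (spin_quotient_gen (modA := modR) (submx_refl _) lI mW eW). Qed.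

Let e_neq0 : e != 0.
Proof. exact: (spin_quotient_neq0 m3 (submx_refl _) lI). Qed.

Lemma spin_dim_eq : d = (2 ^ m)%N.
Proof. exact: (spin_dimE tr3 lI e_fix e_gen e_neq0). Qed.

Lemma socle_eq : (U :=: \sum_(h in H) <<e *m V h>>)%MS.
Proof. exact: (stab_span_socle tr3 lI e_fix e_gen e_neq0 m0). Qed.

Lemma socle_jm : (U :=: kermx (jm V p))%MS.
Proof.
exact: eqmx_trans socle_eq (stab_span_jm tr3 lI e_fix e_gen m0).
Qed.

Lemma socle_rank : \rank U = (2 ^ (m - 1))%N.
Proof. by rewrite socle_eq (stab_span_rank tr3 lI e_fix e_gen e_neq0 m0). Qed.

Lemma socle_singular : totally_singular spin_form U.
Proof.
move=> v; rewrite socle_eq => /sub_sumsmxP[u ->].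
have pe h : e *m V h = proj (pt (h \o l)).
  rewrite -(to_sectionJ modR modS (pt_specht lI) (in_setT h)).
  by congr (proj _); apply: pt_act.
pose a h := u h *m <<e *m V h>>%MS.
(* Over F_2 each summand is 0 or the image of one polytabloid, so the vector lifts to a plain sum of
   polytabloids with unmatched point [p]. *)
pose x (h : 'S_n) := if a h == 0 then 0 else pt (h \o l).
have xP h : x h = 0 \/ x h = pt (h \o l) by rewrite /x; case: ifP => _; [left|right].
have xS h : (x h <= tS)%MS.
  by rewrite /x; case: ifP => _; rewrite ?sub0mx // pt_specht //; apply: perm_label_inj.
have ax h : a h = proj (x h).
  rewrite /x; case: eqVneq => [-> | a0]; first by rewrite [RHS]linear0.
  have : (a h <= e *m V h)%MS by rewrite mulmx_sub ?genmxE.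
  case/sub_rVP=> b bE; case: (F2_cases b) bE => -> bE; last by rewrite bE scale1r pe.
  by rewrite bE scale0r eqxx in a0.
rewrite (eq_bigr (fun h => proj (x h))) => [|h _]; last exact: ax.
rewrite -[X in spin_form X](linear_sum proj) spin_form_proj; last first.
  by rewrite summx_sub.
apply: half_weight_sum => [h k /stabP hp /stabP kp|h _].
  have [->|->] := xP h; first exact: dot0l.
  have [->|->] := xP k; first exact: dot0r.
  by apply: dot_pt_unmatched; rewrite //= ?hp ?kp //; apply: perm_label_inj.
have [->|->] := xP h; first exact: half_weight0.
by apply: half_weight_pt; [apply: leq_trans m3 | apply: perm_label_inj].
Qed.

Lemma socle_conj x : (U *m V x :=: kermx (jm V (x p)))%MS.
Proof.
exact: eqmx_trans (eqmxMr _ socle_jm) (kermx_jm_conj V l x).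
Qed.

Lemma jm_kermx_cap q r : q != r -> (kermx (jm V q) :&: kermx (jm V r) :=: (0 : 'M_d))%MS.
Proof. exact: (kermx_jm_cap tr3). Qed.

End Stabilizer.

End SpinForm.


Theorem theorem1 (m : nat) (hm : (3 <= m)%N) (p : 'I_(2 * m).+1)
    (g : 'I_(2 * m).+1 -> 'S_(2 * m).+1)
    (g1 : g ord0 = 1%g)
    (hg : left_coset_representatives (point_stabilizer p) g) :
  let V := spin_repr m in
  let U := restriction_socle V (subsetT (point_stabilizer p)) in
  let W := fun i => U *m V (g i) in
  exists Q : 'rV['F_2]_(spin_dim m) -> 'F_2,
    [/\ quadratic_form Q,
        nondegenerate_form Q,
        invariant_form V Q,
        partial_orthogonal_spread Q (2 ^ (m - 1))%N W
      & exists theta : 'I_(2 * m).+1 -> 'I_(2 * m).+1,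
          bijective theta /\
          forall (x : 'S_(2 * m).+1) (k : 'I_(2 * m).+1),
            (W (theta k) *m V x :=: W (theta (x k)))%MS].
Proof.
move=> V U W; have [l lI lp] := label_exists p; subst p.
have m0 : (0 < m)%N by apply: leq_trans hm.
have UE x : (U *m V x :=: kermx (jm V (x (l None))))%MS by apply: (socle_conj hm lI).
have memH x h : (x \in point_stabilizer (l None) :* h) = (x (l None) == h (l None)).
  rewrite mem_rcoset; apply/stabP/eqP; rewrite permM => E.
    by rewrite -[in RHS]E permKV.
  by rewrite E permK.
(* A coset of the stabilizer is determined by the image of the point, so [ev] attaches distinct
   points to distinct representatives; [theta] is its inverse. *)
pose ev i := g i (l None).
have ev_inj : injective ev.
  move=> i j E; have [k [_ kU]] := hg (g i).
  by rewrite -(kU i) ?memH // -(kU j) // memH; apply/eqP.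
have [theta thetaK evK] := injF_bij ev_inj.
have Q_inv := spin_form_invariant hm.
have WS i : totally_singular (@spin_form m) (W i).
  move=> v /submxP[w ->]; rewrite mulmxA Q_inv ?in_setT //.
  by apply: (socle_singular hm lI); rewrite submxMl.
have WR i : \rank (W i) = (2 ^ (m - 1))%N.
  by rewrite mxrankMfree ?row_free_unit ?repr_mx_unit ?in_setT // (socle_rank hm lI).
exists (@spin_form m); split => //.
- exact: spin_form_quadratic.
- exact: spin_form_nondegenerate.
- split.
  + by rewrite (spin_dim_eq hm lI) -expnS subn1 prednK.
  + by split; [exact: spin_form_quadratic | exact: spin_form_nondegenerate].
  + by exists (W ord0).
  + by [].
  move=> i j ij; apply: eqmx_trans (cap_eqmx (UE _) (UE _)) _.
  by apply: (jm_kermx_cap hm); rewrite (inj_eq ev_inj).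
exists theta; split; first by exists ev.
move=> x k.
have -> : W (theta k) *m V x = U *m V (g (theta k) * x)%g.
  exact: etrans (esym (mulmxA _ _ _)) (congr1 (mulmx U) (esym (repr_in V _ _))).
apply: eqmx_trans (UE _) (eqmx_trans _ (eqmx_sym (UE _))).
by rewrite permM -/(ev _) -/(ev _) !evK.
Qed.
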